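(* Let $n\ge2$, let $\rho=(n-1,n-2,\ldots,1)$, and let $\tau=-[2]=-(t+t^{-1})$. The (undeformed) maximal specialised Macdonald polynomial $\mathrm{M}_\rho$ expands in the Kazhdan–Lusztig elements as $$\mathrm{M}_\rho=\sum_{\lambda\subseteq\rho}\tau^{-n_\lambda}\,\mathrm{KL}_\lambda ,$$ where $n_\lambda$ is the signed number of boxes of $\rho$ lying outside $\lambda$: $n_\lambda=\sum_{(i,j)\in\rho\setminus\lambda}(-1)^{n-i-j}$.
   Context: Fix a nonzero complex number $t$, not a root of unity; $[k]=\frac{t^k-t^{-k}}{t-t^{-1}}$. Operators. On functions of $z_1,\ldots,z_{2n}$ let $s_i$ exchange $z_i$ and $z_{i+1}$, let $\nabla_i f=\frac{t z_i-t^{-1}z_{i+1}}{z_i-z_{i+1}}(f-s_if)$, and define $T_i(u)=\nabla_i-t^{-1}+\frac{t^{-u}}{[u]}$. Let $\Delta_t(x_1,\ldots,x_N)=\prod_{i<j}(t x_i-t^{-1}x_j)$ and $\Delta\Delta=\Delta_t(z_1,\ldots,z_n)\Delta_t(z_{n+1},\ldots,z_{2n})$. Diagrams. A partition is drawn with rows listed from the top, left-justified; box $(i,j)$ is in row $i$ and column $j$. Given a filling of the boxes of $\lambda\subseteq\rho$ by numbers $v_{ij}$, attach to box $(i,j)$ the operator $T_{n+j-i}(v_{ij})$; the associated polynomial is obtained by applying to $\Delta\Delta$ the operators of all boxes, the operator of a box acting before those of the boxes to its right in the same row and below it in the same column (all admissible orders give the same result). $\mathrm{M}_\rho$ is the polynomial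 associated with the full staircase $\rho$ filled with $v_{ij}=n-i-j+2$ (so $n$ in box $(1,1)$ and $2$ in the corner boxes). $\mathrm{KL}_\lambda$ is the polynomial associated with $\lambda$ filled by $v_{ij}=\max\{v_{i+1,j},v_{i,j+1}\}+1$, where $v_{ij}=0$ for $(i,j)\notin\lambda$; $\mathrm{KL}_\emptyset=\Delta\Delta$. In the sign convention for $n_\lambda$, boxes on the outermost diagonal $i+j=n$ of $\rho$ count $+1$, those on $i+j=n-1$ count $-1$, and so on alternately. E.g. for $n=6$, $\lambda=(3,1)$: $n_\lambda=5-4+2=3$. *)

(* Defs.v *)
(* Mathematical Components, with multinomials and real-closed; the realType
   interface of the real numbers comes from MathComp-Analysis. *)
From HB Require Import structures.
From mathcomp Require Import all_boot all_order all_algebra all_fingroup.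
From mathcomp Require Import mpoly complex reals.
From mathcomp Require Import zify.

Set Implicit Arguments.
Unset Strict Implicit.
Unset Printing Implicit Defensive.

Import GRing.Theory.
Local Open Scope ring_scope.

Definition qnum {C : fieldType} (t : C) (k : int) : C :=
  (t ^ k - t ^ (- k)) / (t - t^-1).

(* Variables are numbered z_1, ..., z_N, so that z_k is 'X_a for the ordinal a
   of value k.-1.  For k out of range, zvar is 0 and zperm is the identity. *)
Definition zvar (C : fieldType) (N k : nat) : {mpoly C[N]} :=
  if (insub k.-1 : option 'I_N) is Some a then 'X_a else 0.

(* The transposition (k, k+1) of the positions 1, ..., N. *)
Definition zperm (N k : nat) : 'S_N :=
  match (insub k.-1 : option 'I_N), (insub k : option 'I_N) with
  | Some a, Some b => tperm a b
  | _, _ => 1%g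
  end.

Definition zswap {C : fieldType} {N : nat} (k : nat) (f : {mpoly C[N]}) :
  {mpoly C[N]} := msym (zperm N k) f.

Lemma msym_tperm_div (C : fieldType) (N : nat) (a b : 'I_N) (f : {mpoly C[N]}) :
  exists g, ('X_a - 'X_b) * g = f - msym (tperm a b) f.
Proof.
elim/mpolyind: f => [|c m p _ _ [g Hg]].
  by exists 0; rewrite mulr0 raddf0 subr0.
pose P (q : {mpoly C[N]}) :=
  exists h, ('X_a - 'X_b) * h = q - msym (tperm a b) q.
suff [h Hh] : P 'X_[m].
  exists (c *: h + g); rewrite linearP /= mulrDr -scalerAr Hh Hg.
  by rewrite scalerBr opprD addrACA.
have PM : forall p q, P p -> P q -> P (p * q).
  move=> p1 q1 [h1 H1] [h2 H2]; exists (h1 * q1 + msym (tperm a b) p1 * h2).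
  rewrite rmorphM /= mulrDr mulrA H1 mulrCA H2 mulrBl mulrBr.
  by rewrite addrA subrK.
have P1 : P 1 by exists 0; rewrite mulr0 rmorph1 subrr.
rewrite mpolyXE_id; apply: (big_ind P) => // i _.
elim: (m i) => [|k IH]; first by rewrite expr0.
rewrite exprS; apply: PM => //.
rewrite /P /msym mmapX mmap1U.
case: tpermP => [->|->|_ _].
- by exists 1; rewrite mulr1.
- by exists (-1); rewrite mulrN1 opprB.
- by exists 0; rewrite mulr0 subrr.
Qed.

Lemma divided_difference_exists {C : fieldType} {N : nat} (k : nat)
    (f : {mpoly C[N]}) :
  exists g, (zvar C N k - zvar C N k.+1) * g == f - zswap k f.
Proof.
rewrite /zswap /zvar /zperm /=.
have msym1 : msym 1%g f = f by rewrite msym1m.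
case: (insub k.-1) => [a|]; last first.
  by exists 0; rewrite msym1 mulr0 subrr.
case: (insub k) => [b|]; last first.
  by exists 0; rewrite msym1 mulr0 subrr.
by have [g Hg] := msym_tperm_div a b f; exists g; apply/eqP.
Qed.

(* (f - s_k f) / (z_k - z_(k+1)) as a polynomial: for 0 < k < N the divisor is
   nonzero, so that the exact quotient chosen here is unique. *)
Definition divided_difference {C : fieldType} {N : nat} (k : nat)
    (f : {mpoly C[N]}) : {mpoly C[N]} :=
  xchoose (divided_difference_exists k f).

Lemma divided_differenceP (C : fieldType) (N k : nat) (f : {mpoly C[N]}) :
  (zvar C N k - zvar C N k.+1) * divided_difference k f = f - zswap k f.
Proof. exact/eqP/(xchooseP (divided_difference_exists k f)). Qed.

Lemma divided_difference_unique (C : fieldType) (N k : nat)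
    (f g : {mpoly C[N]}) :
  (0 < k < N)%N -> (zvar C N k - zvar C N k.+1) * g = f - zswap k f ->
  g = divided_difference k f.
Proof.
case/andP=> k0 kN Hg.
have neq : zvar C N k - zvar C N k.+1 != 0.
  have k1N : (k.-1 < N)%N by rewrite (leq_ltn_trans (leq_pred k)).
  rewrite /zvar /= (insubT (fun x => x < N)%N k1N) (insubT (fun x => x < N)%N kN) /=.
  rewrite subr_eq0; apply/eqP => /(congr1 (mcoeff U_(Ordinal kN)%MM)).
  rewrite !mcoeffX eqxx; case: eqP => [E _|_ /eqP]; last first.
    by rewrite eq_sym oner_eq0.
  have := congr1 (fun m : 'X_{1.. N} => m (Ordinal kN)) E.
  by rewrite !mnm1E eqxx -val_eqE /=; case: eqP => // E2; move: k0 E2; lia.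
by apply: (mulfI neq); rewrite Hg divided_differenceP.
Qed.

Definition nabla {C : fieldType} {N : nat} (t : C) (k : nat)
    (f : {mpoly C[N]}) : {mpoly C[N]} :=
  (t *: zvar C N k - t^-1 *: zvar C N k.+1) * divided_difference k f.

Definition Top {C : fieldType} {N : nat} (t : C) (k : nat) (u : int)
    (f : {mpoly C[N]}) : {mpoly C[N]} :=
  nabla t k f - t^-1 *: f + (t ^ (- u) / qnum t u) *: f.

Definition Delta {C : fieldType} {N M : nat} (t : C)
    (x : 'I_M -> {mpoly C[N]}) : {mpoly C[N]} :=
  \prod_(i < M) \prod_(j < M | (i < j)%N) (t *: x i - t^-1 *: x j).

Definition DeltaDelta {C : fieldType} (t : C) (n : nat) : {mpoly C[n + n]} :=
  Delta t (fun i : 'I_n => 'X_(lshift n i)) *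
  Delta t (fun i : 'I_n => 'X_(rshift n i)).

(* Partitions are weakly decreasing sequences, trailing zeros being allowed. *)
Definition is_partition (la : seq nat) : bool := sorted geq la.

(* Boxes (i, j), numbered from 1, in row-reading order. *)
Definition boxes (la : seq nat) : seq (nat * nat) :=
  [seq (i, j) | i <- iota 1 (size la), j <- iota 1 (nth 0%N la i.-1)].

Lemma mem_boxes (la : seq nat) (i j : nat) :
  ((i, j) \in boxes la) = (0 < i)%N && (0 < j <= nth 0%N la i.-1)%N.
Proof.
apply/allpairsPdep/andP => [[x [y [Hx Hy [-> ->]]]]|[i0 /andP[j0 Hj]]].
  by move: Hx Hy; rewrite !mem_iota !add1n ltnS => /andP[-> _].
exists i, j; rewrite !mem_iota !add1n !ltnS i0 j0 Hj; split=> //=.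
case: leqP => // lt_i; move: Hj; rewrite nth_default ?leqn0; last by lia.
by move: j0; case: j.
Qed.

Definition subdiagram (la mu : seq nat) : bool := all (mem (boxes mu)) (boxes la).

Definition staircase (n : nat) : seq nat := [seq (n - i)%N | i <- iota 1 n.-1].

(* The operators are applied in row-reading order, one of the admissible
   orders: each box comes before the boxes to its right and below it. *)
Definition diagram_poly {C : fieldType} (t : C) (n : nat) (la : seq nat)
    (v : nat -> nat -> int) : {mpoly C[n + n]} :=
  foldl (fun f b => Top t (n + b.2 - b.1) (v b.1 b.2) f) (DeltaDelta t n)
        (boxes la).

Definition Mrho {C : fieldType} (t : C) (n : nat) : {mpoly C[n + n]} :=
  diagram_poly t n (staircase n)
    (fun i j => n%:Z - i%:Z - j%:Z + 2%:Z).

(* The recursion v_ij = max(v_(i+1)j, v_i(j+1)) + 1 is run with a fuel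
   argument, large enough by KL_fillingE. *)
Fixpoint KL_filling_rec (fuel : nat) (la : seq nat) (i j : nat) : nat :=
  if fuel is fuel'.+1 then
    if (i, j) \in boxes la then
      (maxn (KL_filling_rec fuel' la i.+1 j)
            (KL_filling_rec fuel' la i j.+1)).+1
    else 0%N
  else 0%N.

Definition KL_filling (la : seq nat) (i j : nat) : nat :=
  KL_filling_rec (size la + sumn la) la i j.

Lemma mem_boxes_bound (la : seq nat) (i j : nat) : (i, j) \in boxes la ->
  (0 < i)%N && (0 < j)%N && (i + j <= size la + sumn la)%N.
Proof.
rewrite mem_boxes => /and3P[i0 j0 Hj]; rewrite i0 j0 /=.
have Hi : (i.-1 < size la)%N.
  by rewrite ltnNge; apply/negP => /(nth_default 0%N) E; move: j0 Hj; rewrite E; lia.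
have : (nth 0 la i.-1 <= sumn la)%N.
  by rewrite sumnE (big_nth 0%N) big_mkord (bigD1 (Ordinal Hi)) //= leq_addr.
by move: Hi Hj; lia.
Qed.

Lemma KL_filling_recS (la : seq nat) (k i j : nat) :
  (size la + sumn la < k + i + j)%N ->
  KL_filling_rec k.+1 la i j = KL_filling_rec k la i j.
Proof.
elim: k i j => [|k IH] i j Hk.
  rewrite /=; case: ifP => // /mem_boxes_bound; move: Hk; lia.
rewrite [LHS]/= -[in RHS]/(KL_filling_rec k.+1 la i j) [RHS]/=.
by case: ifP => // _; congr (maxn _ _).+1; apply: IH; lia.
Qed.

Lemma KL_fillingE (la : seq nat) (i j : nat) :
  KL_filling la i j =
  if (i, j) \in boxes la then
    (maxn (KL_filling la i.+1 j) (KL_filling la i j.+1)).+1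
  else 0%N.
Proof.
case: (boolP ((i, j) \in boxes la)) => Hij; last first.
  by rewrite /KL_filling; case: (_ + _)%N => //= k; rewrite (negbTE Hij).
have := mem_boxes_bound Hij; rewrite /KL_filling.
case E: (size la + sumn la)%N => [|k]; first by lia.
move=> Hb; rewrite [LHS]/= Hij.
by congr (maxn _ _).+1; rewrite KL_filling_recS //; lia.
Qed.

Definition KL {C : fieldType} (t : C) (n : nat) (la : seq nat) :
    {mpoly C[n + n]} :=
  diagram_poly t n la (fun i j => (KL_filling la i j)%:Z).

Definition nsigned (n : nat) (la : seq nat) : int :=
  \sum_(b <- boxes (staircase n) | b \notin boxes la) (-1) ^+ (n - b.1 - b.2).

Definition tau {C : fieldType} (t : C) : C := - qnum t 2.

(* A partition contained in the staircase has at most n - 1 parts, all of them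
   less than n; padded with zeros it is a unique (n-1)-tuple over 'I_n. *)
Definition parts {n : nat} (la : n.-1.-tuple 'I_n) : seq nat :=
  [seq nat_of_ord i | i <- la].

(* Main.v *)
Require Import Defs.
From HB Require Import structures.
From mathcomp Require Import all_boot all_order all_algebra.
From mathcomp Require Import mpoly complex reals.
From mathcomp Require Import all_fingroup fraction ssrAC boolp functions ring zify.
Import GRing.Theory.
Local Open Scope ring_scope.

Set Implicit Arguments.
Unset Strict Implicit.
Unset Printing Implicit Defensive.

(** Put E_k = nabla_k - [2].  Then E_k ^ 2 = tau E_k, the E_k satisfy the Hecke
    relations, T_k(u) = E_k + [u + 1] / [u], and E_k kills Delta Delta for every
    k != n.  So M_rho and all the KL_lambda are obtained from a vector killed by
    the E_k with k != n by applying the operators T_k along a diagram, and the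
    coefficients of an expansion of M_rho can be computed in another module that
    has such a vector, provided that the expansion itself is known to exist
    simultaneously in both.

    Existence ([kl_triangular]).  In any Hecke module, if v is killed by the E_k
    with k != n, the product along a diagram lambda does not depend on the filling
    up to a combination of the KL_mu with mu strictly inside lambda.  This follows
    from the Yang-Baxter equation in the form of [kl_op_nonpeak]: E_k kills
    KL_lambda unless a box can be added to lambda on the diagonal of k.  The lemma
    is applied to the direct sum of the polynomials and a spin chain.

    The second module consists of the functions on the words in two letters (up
    and down steps); E_k acts as a Temperley-Lieb generator, a cap after a cup, and
    v is the indicator of the word with n ups followed by downs.  Composition with
    a cup ([cup]) maps it to the same object with n - 1 in place of n, so n
    successive cups, that is a link pattern, give a number ([link_eval]).  Link
    patterns, like the lambda inside rho, are indexed by Dyck paths.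

    The KL_lambda are the dual basis of the link patterns ([link_eval_kl]).  This
    rests on [kl_cup_peak]: closing by a cup a peak of the boundary path of lambda
    turns KL_lambda into KL_lambda', where lambda' loses the row and the column
    that meet at the peak.  Closing a pair of steps that is not a peak gives 0.

    The Macdonald product takes on a link pattern the value tau ^ (- e), with e the
    number of arcs that start at an even position ([link_eval_macdonald]).  On the side of
    the polynomials the reason is that M_rho is symmetric in z_1, z_2, in z_3, z_4,
    and so on.  In the spin chain: adding to rho the box on the diagonal of an odd k
    completes a rectangle of half-perimeter n + 1, the product over it is killed by n
    consecutive E_k, and among n + 1 consecutive strands every link pattern with n
    arcs joins two neighbours ([macdonald_null]).  Hence the closings by a cup at two
    neighbouring positions agree up to a factor tau, and one of them is computed
    directly ([macdonald_cup_top]).  Finally e = n_lambda: a row of rho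
    minus lambda contributes to n_lambda the alternating sum 1 - 1 + 1 - ..., which
    is the parity of its length ([nsigned_odd_rows]). *)

(** * Products of box operators along a diagram *)

Lemma subn_pred n i : (n.-1 - i = n - i.+1)%N.
Proof. by rewrite subnS predn_sub. Qed.

Section DiagramOperators.
Variables (C : fieldType) (g : nat -> C).

Definition box_op (V : lmodType C) (E : nat -> V -> V) (k u : nat) (x : V) : V :=
  E k x + g u *: x.

Fixpoint row_op (V : lmodType C) (E : nat -> V -> V) (B : nat) (u : nat -> nat)
    (m : nat) (x : V) : V :=
  if m is m'.+1 then box_op E (B + m') (u m') (row_op E B u m' x) else x.

(** Rows and columns are numbered from 0: box (i, j) carries the index n - i + j.
    The filling is a function of both coordinates, so a tail of the diagram is a
    diagram with base index n.-1 and the shifted filling. *)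
Fixpoint diag_op (V : lmodType C) (E : nat -> V -> V) (n : nat) (la : seq nat)
    (u : nat -> nat -> nat) (x : V) : V :=
  if la is m :: la' then
    diag_op E n.-1 la' (fun i => u i.+1) (row_op E n (u 0%N) m x)
  else x.

Lemma box_op_morph (V W : lmodType C) (F : V -> W) E E' k k' u x :
  linear F -> F (E k x) = E' k' (F x) -> F (box_op E k u x) = box_op E' k' u (F x).
Proof. by move=> linF FE; rewrite /box_op -FE [in LHS]addrC linF [in LHS]addrC. Qed.

Lemma box_op_linear (V : lmodType C) (E : nat -> V -> V) k u :
  linear (E k) -> linear (box_op E k u).
Proof.
move=> linE a x y; rewrite /box_op linE !scalerDr !scalerA.
by rewrite [g u * a]mulrC -!addrA; congr (_ + _); rewrite addrCA.
Qed.

Lemma row_op_morph (V W : lmodType C) (F : V -> W) E E' B B' u m x :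
  (forall j y, (j < m)%N ->
     F (box_op E (B + j) (u j) y) = box_op E' (B' + j) (u j) (F y)) ->
  F (row_op E B u m x) = row_op E' B' u m (F x).
Proof.
elim: m => //= m IH H; rewrite H // IH // => j y jm; apply: H; lia.
Qed.

(** Transports products along a diagram by any map that intertwines the operators of
    the individual boxes: projections of a direct sum, a cup that shifts the
    indices, or an operator that commutes with all the boxes. *)
Lemma diag_op_morph (V W : lmodType C) (F : V -> W) E E' n n' la u x :
  (forall i j y, (j < nth 0 la i)%N ->
     F (box_op E (n - i + j) (u i j) y) = box_op E' (n' - i + j) (u i j) (F y)) ->
  F (diag_op E n la u x) = diag_op E' n' la u (F x).
Proof.
elim: la n n' u x => //= m la IH n n' u x H.
rewrite (IH _ n'.-1).
  congr diag_op; apply: row_op_morph => j y jm.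
  by have := H 0%N j y jm; rewrite !subn0.
move=> i j y ij; have := H i.+1 j y ij.
by rewrite !subn_pred.
Qed.

Variables (V : lmodType C) (E : nat -> V -> V).
Implicit Types (x y : V) (la : seq nat).

Lemma eq_row_op B u u' m x :
  (forall j, (j < m)%N -> u j = u' j) -> row_op E B u m x = row_op E B u' m x.
Proof. by elim: m => //= m IH H; rewrite IH ?H // => j jm; apply: H; lia. Qed.

Lemma eq_diag_op n la u u' x :
  (forall i j, (j < nth 0 la i)%N -> u i j = u' i j) ->
  diag_op E n la u x = diag_op E n la u' x.
Proof.
elim: la n u u' x => //= m la IH n u u' x H.
rewrite (@eq_row_op _ _ (u' 0%N)) => [|j jm]; last exact: (H 0%N).
by apply: IH => i j; apply: (H i.+1).
Qed.

Lemma row_op_split B u m p x :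
  row_op E B u (p + m) x = row_op E (B + p) (fun j => u (p + j)%N) m (row_op E B u p x).
Proof. by elim: m => [|m IH]; rewrite ?addn0 // addnS /= IH addnA. Qed.

Lemma diag_op_cat n s1 s2 u x :
  diag_op E n (s1 ++ s2) u x =
  diag_op E (n - size s1) s2 (fun i => u (size s1 + i)%N) (diag_op E n s1 u x).
Proof.
elim: s1 n u x => [|m s1 IH] n u x /=; first by rewrite subn0.
by rewrite IH subn_pred.
Qed.

Lemma diag_op_rcons n s m u x :
  diag_op E n (rcons s m) u x =
  row_op E (n - size s) (u (size s)) m (diag_op E n s u x).
Proof. by rewrite -cats1 diag_op_cat /= addn0. Qed.

Lemma diag_op_zeros n la u x : all (pred1 0%N) la -> diag_op E n la u x = x.
Proof. by elim: la n u => //= m la IH n u /andP[/eqP-> /IH ->]. Qed.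

Lemma diag_op_closed (P : V -> Prop) n la u x :
  (forall i j y, (j < nth 0 la i)%N -> P y -> P (box_op E (n - i + j) (u i j) y)) ->
  P x -> P (diag_op E n la u x).
Proof.
elim: la n u x => //= m la IH n u x H Px; apply: IH => [i j y ij Py|].
  rewrite subn_pred.
  exact: (H i.+1).
have: forall j y, (j < m)%N -> P y -> P (box_op E (n + j) (u 0%N j) y).
  by move=> j y jm; have := H 0%N j y jm; rewrite subn0.
elim: m {H} => //= m IHm H; apply: (H) => //; apply: IHm => j y jm; apply: H; lia.
Qed.

End DiagramOperators.

(** * Hecke modules and the Yang-Baxter equation *)

(** The index k is restricted to 0 < k < N because the polynomial module has only
    N variables. *)
Record hecke_module (C : fieldType) (V : lmodType C) (tau : C) (N : nat)
    (E : nat -> V -> V) : Prop := HeckeModule {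
  hecke_linear : forall k, linear (E k);
  hecke_quad : forall k x, (0 < k < N)%N -> E k (E k x) = tau *: E k x;
  hecke_comm : forall k l x, (0 < k)%N -> (k.+1 < l)%N -> (l < N)%N ->
    E k (E l x) = E l (E k x);
  hecke_braid : forall k x, (0 < k)%N -> (k.+1 < N)%N ->
    E k (E k.+1 (E k x)) - E k x = E k.+1 (E k (E k.+1 x)) - E k.+1 x
}.

(** The values g u = [u + 1] / [u] enter the Yang-Baxter equation only through these
    two identities. *)
Record baxter_weight (C : fieldType) (tau : C) (g : nat -> C) : Prop :=
  BaxterWeight {
  baxter1 : g 1%N = - tau;
  baxterS : forall u, (0 < u)%N -> g u * g u.+1 = - tau * g u - 1
}.

Section HeckeModule.
Variables (C : fieldType) (V : lmodType C) (tau : C) (N : nat).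
Variables (E : nat -> V -> V) (g : nat -> C).
Hypothesis heckeE : hecke_module tau N E.
Hypothesis baxterg : baxter_weight tau g.

Notation T := (box_op g E).
Notation row := (row_op g E).
Notation diag := (diag_op g E).

Lemma heckeD k x y : E k (x + y) = E k x + E k y.
Proof. by have := hecke_linear heckeE k 1 x y; rewrite !scale1r. Qed.

Lemma hecke0 k : E k 0 = 0.
Proof. by apply: (addrI (E k 0)); rewrite -heckeD !addr0. Qed.

Lemma heckeZ k a x : E k (a *: x) = a *: E k x.
Proof. by have := hecke_linear heckeE k a x 0; rewrite hecke0 !addr0. Qed.

Lemma hecke_box_op_linear k u : linear (T k u).
Proof. exact/box_op_linear/(hecke_linear heckeE). Qed.

Lemma box_op0 k u : T k u 0 = 0.
Proof. by rewrite /box_op hecke0 scaler0 addr0. Qed.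

Lemma row_op0 B u m : row B u m 0 = 0.
Proof. by elim: m => //= m ->; rewrite box_op0. Qed.

Lemma diag_op0 n la u : diag n la u 0 = 0.
Proof. by elim: la n u => //= m la IH n u; rewrite row_op0. Qed.

Lemma hecke_comm2 k l x : (0 < k < N)%N -> (0 < l < N)%N ->
  (k.+1 < l)%N || (l.+1 < k)%N -> E k (E l x) = E l (E k x).
Proof.
move=> k0 l0 /orP[kl|lk]; last (apply: esym); apply: (hecke_comm heckeE); lia.
Qed.

Lemma hecke_box_op_comm k l u x : (0 < k < N)%N -> (0 < l < N)%N ->
  (k.+1 < l)%N || (l.+1 < k)%N -> E k (T l u x) = T l u (E k x).
Proof.
move=> k0 l0 kl; apply: box_op_morph; first exact: (hecke_linear heckeE).
exact: hecke_comm2.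
Qed.

Lemma box_op_comm k l u v x : (0 < k < N)%N -> (0 < l < N)%N ->
  (k.+1 < l)%N || (l.+1 < k)%N -> T k u (T l v x) = T l v (T k u x).
Proof.
move=> k0 l0 kl; apply: box_op_morph; first exact: hecke_box_op_linear.
by rewrite -hecke_box_op_comm // orbC.
Qed.

Lemma hecke_row_comm k B u m x : (0 < k < N)%N -> (0 < B)%N ->
  (B + m <= N)%N -> (k.+1 < B)%N || (B + m < k)%N ->
  E k (row B u m x) = row B u m (E k x).
Proof.
move=> k0 B0 BN kB; apply: (row_op_morph (F := E k)) => j y jm.
by apply: hecke_box_op_comm; lia.
Qed.

Lemma hecke_diag_comm k n la u x : (0 < k < N)%N ->
  (forall i j, (j < nth 0 la i)%N -> (0 < n - i + j < N)%N /\
     ((k.+1 < n - i + j)%N || ((n - i + j).+1 < k)%N)) ->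
  E k (diag n la u x) = diag n la u (E k x).
Proof.
move=> k0 H; apply: (diag_op_morph (F := E k)) => i j y ij.
by have [? ?] := H i j ij; apply: hecke_box_op_comm.
Qed.

Lemma box_op1_kill k x : (0 < k < N)%N -> E k (T k 1 x) = 0.
Proof.
move=> k0; rewrite /box_op heckeD heckeZ (hecke_quad heckeE) // (baxter1 baxterg).
by rewrite scaleNr subrr.
Qed.

(** E is the box operator at u = - 1, so the Yang-Baxter equation reads
    E_k T_(k+1)(u) T_k(u+1) = T_(k+1)(u+1) T_k(u) E_(k+1); this is
    the inclusion of kernels that it gives. *)
Lemma yang_baxter_up k u x : (0 < k)%N -> (k.+1 < N)%N -> (0 < u)%N ->
  E k.+1 x = 0 -> E k (T k.+1 u (T k u.+1 x)) = 0.
Proof.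
move=> k0 kN u0 Ex.
have := hecke_braid heckeE x k0 kN; rewrite Ex !hecke0 subrr => Hb.
rewrite /box_op !(heckeD, heckeZ, scalerDr) Ex !(hecke0, scaler0) addr0.
rewrite (hecke_quad heckeE) ?scalerA; last by lia.
rewrite (baxterS baxterg) // (subr0_eq Hb).
by rewrite -{1}[E k x]scale1r -!scalerDl (_ : _ + _ = 0) ?scale0r //; ring.
Qed.

Lemma yang_baxter_down k u x : (0 < k)%N -> (k.+1 < N)%N -> (0 < u)%N ->
  E k x = 0 -> E k.+1 (T k u (T k.+1 u.+1 x)) = 0.
Proof.
move=> k0 kN u0 Ex.
have := hecke_braid heckeE x k0 kN; rewrite Ex !hecke0 subrr => /esym Hb.
rewrite /box_op !(heckeD, heckeZ, scalerDr) Ex !(hecke0, scaler0) addr0.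
rewrite (hecke_quad heckeE) ?scalerA; last by lia.
rewrite (baxterS baxterg) // (subr0_eq Hb).
by rewrite -{1}[E k.+1 x]scale1r -!scalerDl (_ : _ + _ = 0) ?scale0r //; ring.
Qed.

(** In a row, a pair of adjacent boxes with consecutive fillings lets E pass to the
    row above, one diagonal further. *)
Lemma row_op_kill B u b m x : (0 < B)%N -> (B + m <= N)%N -> (b.+1 < m)%N ->
  (0 < u b.+1)%N -> u b = (u b.+1).+1 ->
  E (B + b).+1 x = 0 -> E (B + b) (row B u m x) = 0.
Proof.
move=> B0 BN bm u0 ub Ex.
rewrite -(subnKC bm) row_op_split hecke_row_comm /= ?addnS; try lia.
have -> : b = (b + 0)%N by lia.
rewrite !addn0 ub yang_baxter_up ?row_op0 //; try lia.
by rewrite hecke_row_comm ?Ex ?row_op0 //; lia.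
Qed.

(** Two equal rows whose fillings differ by one let E at their right end pass to
    their left end. *)
Lemma row_op2_kill B u u' m x : (0 < B)%N -> (B + m < N)%N ->
  (forall j, (j < m)%N -> (0 < u' j)%N /\ u j = (u' j).+1) ->
  E B x = 0 -> E (B + m) (row B u' m (row B.+1 u m x)) = 0.
Proof.
move=> B0; elim: m => [|m IH] BN H Ex; first by rewrite addn0.
have [u0 uE] := H m (ltnSn m).
have swap y : row B u' m (T (B.+1 + m)%N (u m) y) =
              T (B.+1 + m)%N (u m) (row B u' m y).
  by apply/esym/row_op_morph => j z jm; apply: box_op_comm; lia.
rewrite /= swap {swap}.
rewrite addnS addSn uE yang_baxter_down //; try lia.
by apply: IH => //; [lia|move=> j jm; apply: H; lia].
Qed.

End HeckeModule.

(** * Kazhdan-Lusztig fillings *)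

Definition klrow_step (m : nat) (v : nat -> nat) (j : nat) : nat :=
  if (j < m)%N then maxn (v j).+1 (m - j) else 0%N.

(** The first row of the filling v_ij = max (v_(i+1)j, v_i(j+1)) + 1, as a function of
    the column.  Since the entries drop by at least one along a row, the recursion
    along the row collapses to a maximum over the row below and the arm length. *)
Fixpoint klrow (la : seq nat) : nat -> nat :=
  if la is m :: la' then klrow_step m (klrow la') else fun=> 0%N.

Definition klfill (la : seq nat) (i j : nat) : nat := klrow (drop i la) j.

(** The boundary path of la has the up step of row i at position n - i + la_i; ups
    are rows and downs are columns.  A peak is an up at k followed by a down at
    k + 1, equivalently a place where a box of index k can be added.  The row m is
    allowed to be empty. *)
Definition is_peak (n : nat) (la : seq nat) (k : nat) : Prop :=
  exists l1 m l2, [/\ la = l1 ++ m :: l2, all (ltn m) l1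
                    & k = (n - size l1 + m)%N].

Lemma klrow_gt0 la j : (0 < klrow la j)%N = (j < head 0 la)%N.
Proof.
case: la => //= m la; rewrite /klrow_step; case: ifP => //; lia.
Qed.

(** Locates position k on the boundary path: it lies between the up steps of the last
    row of l1 and of the first row of l2, or at the latter. *)
Lemma path_position la n k :
  pairwise geq la -> (size la <= n)%N ->
  exists l1 l2, [/\ la = l1 ++ l2,
     forall i, (i < size l1)%N -> (k < n - i + nth 0 l1 i)%N
   & (l2 = [::] \/ n - size l1 + head 0 l2 <= k)%N].
Proof.
elim: la n => [|m la IH] n /=; first by exists [::], [::]; split=> //; left.
move=> /andP[mla pla] szn.
case: (leqP (n + m) k) => km.
  by exists [::], (m :: la); split=> //=; right; rewrite subn0.
have [|l1 [l2 [-> H1 H2]]] := IH n.-1 pla; first by lia.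
exists (m :: l1), l2; split=> //=.
  move=> [|i] /=; first by rewrite subn0.
  by move=> /H1; rewrite subn_pred.
by case: H2; [left|right; rewrite subnS; lia].
Qed.

Lemma klrow_out la j : (head 0 la <= j)%N -> klrow la j = 0%N.
Proof. by case: la => //= m la; rewrite /klrow_step ltnNge => ->. Qed.

Lemma klrow_corner m la : (head 0 la <= m)%N -> klrow (m.+1 :: la) m = 1%N.
Proof. by move=> h; rewrite /= /klrow_step ltnSn klrow_out //; lia. Qed.

Lemma klrow_equal_columns l1 l2 b : l1 != [::] ->
  all (leq b.+2) l1 -> (head 0 l2 <= b)%N ->
  klrow (l1 ++ l2) b = (klrow (l1 ++ l2) b.+1).+1.
Proof.
elim: l1 => //= m l1 IH _ /andP[bm bl1] hl2; rewrite /klrow_step.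
have -> : (b < m)%N by lia.
rewrite bm; case: l1 IH bl1 => [_ _|m' l1 IH bl1].
  by rewrite /= !klrow_out //; lia.
by rewrite IH //; lia.
Qed.

Lemma pairwise_geq_nth la i : pairwise geq la -> (nth 0 la i <= head 0 la)%N.
Proof.
case: la i => [|m la] [|i] //=.
case/andP=> /allP mla _; case: (ltnP i (size la)) => h.
  by apply: mla; rewrite mem_nth.
by rewrite nth_default.
Qed.

Section NonPeak.
Variables (C : fieldType) (V : lmodType C) (tau : C) (N : nat).
Variables (E : nat -> V -> V) (g : nat -> C).
Hypothesis heckeE : hecke_module tau N E.
Hypothesis baxterg : baxter_weight tau g.

(** All rows reach the columns b and b + 1, whose fillings are consecutive, so E
    moves from the bottom of the two columns to their top. *)
Lemma columns_kill n la u b x : (size la <= n)%N ->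
  all (fun m => (b.+1 < m)%N && (n + m <= N)%N) la ->
  (forall i, (i < size la)%N -> (0 < u i b.+1)%N /\ u i b = (u i b.+1).+1) ->
  E (n + b).+1 x = 0 -> E (n - size la + b).+1 (diag_op g E n la u x) = 0.
Proof.
elim/last_ind: la => [|s m IH]; first by rewrite subn0.
rewrite size_rcons all_rcons => szn /andP[/andP[bm mN] sN] H Ex.
rewrite diag_op_rcons.
have [u0 uE] := H (size s) (ltnSn _).
have -> : (n - (size s).+1 + b).+1 = (n - size s + b)%N by lia.
apply: (row_op_kill heckeE baxterg) => //; try lia.
by apply: IH => // [|i si]; [lia|apply: H; lia].
Qed.

Definition kl_op n la x := diag_op g E n la (klfill la) x.

Lemma kl_op_cat n l1 l2 x :
  kl_op n (l1 ++ l2) x =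
  kl_op (n - size l1) l2 (diag_op g E n l1 (klfill (l1 ++ l2)) x).
Proof.
rewrite /kl_op diag_op_cat; apply: eq_diag_op => i j _.
by rewrite /klfill drop_cat ltnNge leq_addr /= addKn.
Qed.

(** Steps k, k + 1 of the boundary path that do not form a peak are down-up, up-up or
    down-down.  A down-up is a corner, filled with 1, and E_k T_k(1) = 0.  Two ups
    are two equal rows and two downs are two equal columns; there the filling decreases
    by exactly one, and the Yang-Baxter equation moves E_k across the diagram
    to an index at which it kills x. *)
Lemma kl_op_nonpeak n la x k : pairwise geq la -> (size la <= n)%N ->
  (n + head 0 la <= N)%N ->
  (forall l, (n - size la < l < N)%N -> l != n -> E l x = 0) ->
  (n - size la < k < N)%N -> ~ is_peak n la k -> E k (kl_op n la x) = 0.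
Proof.
move=> pla szn hN Hx /andP[k0 kN] npk.
have [l1 [l2 [E12 H1 H2]]] := path_position k pla szn.
have hB m : m \in la -> (n + m <= N)%N.
  move=> mla; have := pairwise_geq_nth (index m la) pla; rewrite nth_index //.
  by move: hN; lia.
have [pl1 pl2] : pairwise geq l1 /\ pairwise geq l2.
  by move: pla; rewrite E12 pairwise_cat => /and3P[].
have szE : size la = (size l1 + size l2)%N by rewrite E12 size_cat.
(* the boxes of the rows in l2 commute with E k once they end before it *)
have comm2 B (s : seq nat) u y : (size s <= B)%N ->
    pairwise geq s -> (B + head 0 s <= N)%N -> (B + head 0 s < k)%N ->
    E k (diag_op g E B s u y) = diag_op g E B s u (E k y).
  move=> szs ps hs sk; apply: (hecke_diag_comm _ heckeE); first lia.
  move=> i j ij; have := pairwise_geq_nth i ps.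
  have si : (i < size s)%N by case: (ltnP i (size s)) ij => // /(nth_default 0%N)->.
  by lia.
case: (lastP l1) E12 H1 H2 pl1 szE => [|s m] E12 H1 H2 pl1 szE.
  move: E12 => /= E12; subst l2.
  case: la npk pla szn hN Hx k0 H2 {hB pl2 szE} => [|m la] npk pla szn hN Hx k0 H2.
    by rewrite /= in Hx k0; rewrite /kl_op /= Hx //; lia.
  case: H2 => [//|]; rewrite subn0 leq_eqVlt => /orP[/eqP hk|hk].
    by case: npk; exists [::], m, la; rewrite subn0.
  rewrite /kl_op comm2 // Hx ?(diag_op0 _ heckeE) //=; lia.
rewrite size_rcons in H1 H2 szE.
have km : (k < n - size s + m)%N.
  by have := H1 (size s) (ltnSn _); rewrite nth_rcons ltnn eqxx.
move: pl1; rewrite pairwise_rcons => /andP[sm ps].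
have hBm : (n + m <= N)%N by apply: hB; rewrite E12 mem_cat mem_rcons inE eqxx.
have hB2 : (n + head 0 l2 <= N)%N.
  case: (l2) E12 => [|m2 l3] E12 /=; first by lia.
  by apply: hB; rewrite E12 mem_cat inE eqxx orbT.
have ml2 : (head 0 l2 <= m)%N.
  case: (l2) E12 => [|m2 l3] // E12; move: pla.
  by rewrite E12 pairwise_cat allrel_consr all_rcons => /andP[/andP[/andP[]]].
move: km; rewrite leq_eqVlt => /orP[/eqP km|km].
  (* an up step at k.+1: two equal rows, or a corner *)
  case: (boolP ((l2 != [::]) && (head 0 l2 == m))).
    case: l2 E12 H2 szE pl2 hB2 ml2 => //= m2 l3 E12 H2 szE pl2 hB2 ml2.
    move/eqP => m2E; subst m2; case/andP: pl2 => ml3 pl3.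
    have laE : la = s ++ m :: m :: l3 by rewrite E12 cat_rcons.
    have hl3 : (head 0 l3 <= m)%N by case: (l3) ml3 => [|a l] //= /andP[].
    rewrite /kl_op laE diag_op_cat /= comm2 //; try lia.
    rewrite -laE /klfill addn0 addn1 laE !drop_cat ltnn subnn ltnNge leqnSn /=.
    have [B BE] : exists B, (n - size s = B.+1)%N by exists (n - size s).-1; lia.
    have -> : k = (B + m)%N by lia.
    rewrite BE /=.
    rewrite (row_op2_kill heckeE baxterg) ?(diag_op0 _ heckeE) //; try lia.
      move=> j jm; split; last by rewrite subSnn /= /klrow_step jm; lia.
      by rewrite subSnn /= /klrow_step jm; lia.
    rewrite (hecke_diag_comm _ heckeE) ?Hx ?(diag_op0 _ heckeE) //; try lia.
    move=> i j ij; have is_ : (i < size s)%N.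
      by case: (ltnP i (size s)) ij => // /(nth_default 0%N)->.
    have : nth 0%N s i \in la by rewrite laE mem_cat mem_nth.
    by move/hB; lia.
  move=> nl2; have mE : m = m.-1.+1.
    by case: (l2) nl2 szE ml2 => [|m2 l3] /= *; lia.
  have hm : (head 0 l2 <= m.-1)%N.
    by case: (l2) nl2 ml2 => [|m2 l3] /= *; lia.
  have laE : la = s ++ m.-1.+1 :: l2 by rewrite -mE E12 cat_rcons.
  rewrite /kl_op laE diag_op_cat /= comm2 //; try lia.
  rewrite -laE /klfill addn0 laE drop_cat ltnn subnn.
  rewrite (_ : drop 0 _ = m.-1.+1 :: l2) // klrow_corner //.
  have -> : (n - size s + m.-1)%N = k by lia.
  by rewrite (box_op1_kill heckeE baxterg) ?(diag_op0 _ heckeE) //; lia.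
(* a down step at k.+1: an up step at k would make a peak *)
case: (boolP ((l2 != [::]) && (n - (size s).+1 + head 0 l2 == k)%N)).
  case: l2 E12 H2 pl2 szE hB2 ml2 => // m2 l2 E12 H2 pl2 szE hB2 ml2 /= /eqP hk.
  case: npk; exists (rcons s m), m2, l2; rewrite size_rcons hk; split=> //.
  rewrite all_rcons /= (_ : (m2 < m)%N) /=; last by lia.
  by apply: sub_all sm => x' /=; lia.
move=> nhk.
have hk : (n - (size s).+1 + head 0 l2 < k)%N.
  case: (l2) H2 nhk szE => [|m2 l3]; first by rewrite /=; lia.
  by case=> // /= *; lia.
have [b bE] : exists b, k = (n - (size s).+1 + b).+1.
  by exists (k.-1 - (n - (size s).+1))%N; lia.
rewrite E12 kl_op_cat size_rcons /kl_op comm2 //; try lia.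
have bm x' : x' \in rcons s m -> (b.+1 < x')%N.
  rewrite mem_rcons inE => /orP[/eqP->|/(allP sm)] /=; lia.
rewrite bE -(size_rcons s m) columns_kill ?(diag_op0 _ heckeE) //.
- by rewrite size_rcons; lia.
- apply/allP => x' x's; rewrite bm // hB //.
  by rewrite E12 mem_cat x's.
- move=> i is_; rewrite /klfill drop_cat is_.
  have hd : (b.+1 < nth 0%N (rcons s m) i)%N by apply: bm; rewrite mem_nth.
  rewrite klrow_gt0 -klrow_equal_columns; last by lia.
  + by split=> //; rewrite (drop_nth 0%N).
  + by rewrite (drop_nth 0%N).
  + by apply/allP => x' /mem_drop /bm.
- by apply: Hx; lia.
Qed.

End NonPeak.

(** * Triangularity of the change of filling *)

(** The default value 0 keeps the order true beyond the last row. *)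
Lemma pairwise_geqP la :
  reflect (forall i j, (i <= j)%N -> (nth 0 la j <= nth 0 la i)%N) (pairwise geq la).
Proof.
apply: (iffP (pairwiseP 0%N)) => [H i j ij|H i j _ _ ij]; last by apply: H; lia.
case: (ltnP j (size la)) => jl; last by rewrite (nth_default _ jl).
move: ij; rewrite leq_eqVlt => /orP[/eqP->//|ij].
by apply: H; rewrite ?inE //; lia.
Qed.

Lemma nth_update (l1 l2 : seq nat) m m' i :
  nth 0%N (l1 ++ m' :: l2) i =
  if i == size l1 then m' else nth 0%N (l1 ++ m :: l2) i.
Proof.
rewrite !nth_cat; case: ltngtP => //= h; last by rewrite h subnn.
by rewrite (_ : i - size l1 = (i - size l1).-1.+1)%N //; lia.
Qed.

Lemma sumn_lt (s1 s2 : seq nat) : size s1 = size s2 ->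
  (forall i, (nth 0 s1 i <= nth 0 s2 i)%N) -> s1 != s2 -> (sumn s1 < sumn s2)%N.
Proof.
elim: s1 s2 => [|a s1 IH] [|b s2] //= [sz] H.
have ab : (a <= b)%N := H 0%N.
have H' i : (nth 0 s1 i <= nth 0 s2 i)%N := H i.+1.
rewrite eqseq_cons; case: (eqVneq s1 s2) => [->|ne _].
  by rewrite andbT; lia.
by have := IH s2 sz H' ne; lia.
Qed.

Lemma last_corner (la : seq nat) :
  all (pred1 0%N) la \/
  exists l1 m l2, la = l1 ++ m.+1 :: l2 /\ all (pred1 0%N) l2.
Proof.
elim: la => [|m la [IH|[l1 [m' [l2 [-> H]]]]]]; first by left.
  case: m => [|m]; first by left.
  by right; exists [::], m, la.
by right; exists (m :: l1), m', l2.
Qed.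

Section Triangularity.
Variables (C : fieldType) (V : lmodType C) (tau : C) (N : nat).
Variables (E : nat -> V -> V) (g : nat -> C).
Hypothesis heckeE : hecke_module tau N E.
Hypothesis baxterg : baxter_weight tau g.

Lemma diag_op_add_box n l1 m l2 u x :
  pairwise geq (l1 ++ m :: l2) -> (size (l1 ++ m :: l2) <= n)%N ->
  (n - size l1 + m < N)%N ->
  diag_op g E n (l1 ++ m.+1 :: l2) u x =
  box_op g E (n - size l1 + m) (u (size l1) m) (diag_op g E n (l1 ++ m :: l2) u x).
Proof.
rewrite pairwise_cat /= size_cat /= => /and3P[_ _ /andP[ml2 _]] szn mN.
rewrite !diag_op_cat /= addn0; apply: esym.
apply: (diag_op_morph (F := box_op g E (n - size l1 + m) (u (size l1) m))) => i j y ij.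
have il : (i < size l2)%N by case: (ltnP i (size l2)) ij => // /(nth_default 0%N)->.
have := allP ml2 _ (mem_nth 0%N il); rewrite /= => ml.
by apply: (box_op_comm _ heckeE); lia.
Qed.

Variables (n : nat) (v : V).
Hypothesis v_kill : forall k, (0 < k < N)%N -> k != n -> E k v = 0.

Definition diagram_fits la :=
  [/\ pairwise geq la, (size la <= n)%N & (n + head 0 la <= N)%N].

(** The span of the smaller KL elements is replaced by an arbitrary subspace P that
    contains them, so that the induction can be applied to the preimage of P by a box
    operator.  Induction on the number of boxes: remove the last box, of index i0,
    which leaves mu0.  On the smaller diagrams ka inside mu0, E_i0 either kills
    KL_ka, or adds a box to ka, and the result is again strictly smaller than la. *)
Lemma kl_triangular la (P : V -> Prop) : diagram_fits la ->
  P 0 -> (forall a x y, P x -> P y -> P (a *: x + y)) ->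
  (forall mu, pairwise geq mu -> size mu = size la ->
     (forall i, (nth 0 mu i <= nth 0 la i)%N) -> mu != la -> P (kl_op E g n mu v)) ->
  forall u, P (diag_op g E n la u v - kl_op E g n la v).
Proof.
elim/ltn_ind: {la}(sumn la) {-2}la (erefl (sumn la)) P
  => s IH la sE P [pla szn hN] P0 PL PK u.
case: (last_corner la) => [la0|[l1 [m [l2 [laE l20]]]]].
  by rewrite /kl_op !diag_op_zeros // subrr.
pose mu0 := l1 ++ m :: l2.
have nthmu i : nth 0%N mu0 i = if i == size l1 then m else nth 0%N la i.
  by rewrite laE; apply: nth_update.
have nthla : nth 0%N la (size l1) = m.+1 by rewrite laE nth_cat ltnn subnn.
have l2le i : (size l1 < i)%N -> (nth 0%N la i <= 0)%N.
  move=> li; rewrite laE nth_cat ltnNge (ltnW li) /=.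
  rewrite (_ : i - size l1 = (i - size l1).-1.+1)%N /=; last by lia.
  case: (ltnP (i - size l1).-1 (size l2)) => h; last by rewrite nth_default.
  by have := allP l20 _ (mem_nth 0%N h) => /= /eqP->.
move/pairwise_geqP: pla => pla.
have pmu0 : pairwise geq mu0.
  apply/pairwise_geqP => i j ij; rewrite !nthmu.
  have := pla _ _ ij.
  case: (eqVneq i (size l1)) => [ei|ni]; case: (eqVneq j (size l1)) => [ej|nj] //.
    have h : (size l1 < j)%N by lia.
    by have := l2le j h; lia.
  by rewrite ej nthla; lia.
have szmu0 : size mu0 = size la by rewrite laE /mu0 !size_cat.
have ltmu0 : mu0 != la.
  by apply/eqP => h; have := nthmu (size l1); rewrite eqxx h nthla; lia.
have lemu0 i : (nth 0 mu0 i <= nth 0 la i)%N.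
  by rewrite nthmu; case: eqP => // ->; rewrite nthla.
have PZ a x : P x -> P (a *: x) by move=> Px; rewrite -[a *: x]addr0; apply: (PL).
have PD x y : P x -> P y -> P (x + y).
  by move=> Px Py; rewrite -[x]scale1r; apply: (PL).
have ltla (mu : seq nat) : size mu = size la ->
    (forall i, (nth 0 mu i <= nth 0 la i)%N) -> mu != la -> (sumn mu < s)%N.
  by move=> sz le ne; rewrite -sE; apply: sumn_lt.
have szl1 : (size l1 < size la)%N by rewrite laE size_cat /=; lia.
have hmla : (m < head 0 la)%N by have := pla 0%N _ (leq0n (size l1)); rewrite nthla nth0.
pose i0 := (n - size l1 + m)%N.
have i0N : (0 < i0 < N)%N by rewrite /i0; lia.
(* E i0 maps the smaller KL elements into P *)
have PE ka : pairwise geq ka -> size ka = size la ->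
    (forall i, (nth 0 ka i <= nth 0 mu0 i)%N) -> ka != mu0 -> P (E i0 (kl_op E g n ka v)).
  move=> pka szka leka neka.
  have leka' i : (nth 0 ka i <= nth 0 la i)%N by apply: leq_trans (leka i) (lemu0 i).
  have neka' : ka != la.
    apply/eqP => h; have := leka (size l1).
    by rewrite h nthmu eqxx nthla ltnn.
  have hka : (head 0 ka <= head 0 la)%N by rewrite -!nth0; apply: leka'.
  have [|npk] := EM (is_peak n ka i0); last first.
    rewrite (kl_op_nonpeak heckeE baxterg) //; try lia.
    by move=> l hl ln; apply: v_kill => //; lia.
  case=> k1 [m1 [k2 [kaE hk1 i0E]]].
  pose ka' := k1 ++ m1.+1 :: k2.
  have nthk' i : nth 0%N ka' i = if i == size k1 then m1.+1 else nth 0%N ka i.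
    by rewrite kaE; apply: nth_update.
  have nthka : nth 0%N ka (size k1) = m1 by rewrite kaE nth_cat ltnn subnn.
  have szk1 : (size k1 < size ka)%N by rewrite kaE size_cat /=; lia.
  move/pairwise_geqP: (pka) => pka'.
  have pk' : pairwise geq ka'.
    apply/pairwise_geqP => i j ij; rewrite !nthk'.
    case: (eqVneq i (size k1)) => [ei|ni]; case: (eqVneq j (size k1)) => [ej|nj] //.
    - by have := pka' _ _ ij; rewrite ei nthka; lia.
    - have ik : (i < size k1)%N by lia.
      rewrite kaE nth_cat ik; exact: (allP hk1 _ (mem_nth 0%N ik)).
    - exact: pka'.
  have lek' i : (nth 0 ka' i <= nth 0 la i)%N.
    rewrite nthk'; case: eqP => // ->.
    have := leka (size k1); rewrite nthka nthmu.
    case: eqP => [->|ne]; first by rewrite nthla; lia.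
    case: (ltnP (size k1) (size l1)) => h.
      by have := pla _ _ (ltnW h); rewrite nthla; move: i0E; rewrite /i0; lia.
    by have := l2le (size k1); move: i0E; rewrite /i0; lia.
  have szk' : size ka' = size la by rewrite -szka kaE !size_cat.
  have nek' : ka' != la.
    apply: contraNneq neka => h; apply/eqP/(@eq_from_nth _ 0%N).
      by rewrite szka.
    have ek1 : size k1 = size l1.
      apply/eqP; rewrite -[_ == _]negbK; apply/negP => ne.
      have := nthk' (size l1); rewrite h nthla eq_sym (negbTE ne) => h1.
      by have := leka (size l1); rewrite -h1 nthmu eqxx ltnn.
    move=> i _; rewrite nthmu -h nthk' ek1; case: eqP => // ->.
    by rewrite -ek1 nthka; move: i0E; rewrite ek1 /i0; lia.
  pose u' i j := if (i == size k1) && (j == m1) then 1%N else klfill ka i j.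
  have TE : box_op g E i0 1 (kl_op E g n ka v) = diag_op g E n ka' u' v.
    rewrite diag_op_add_box -?kaE ?szka -?i0E //; last by case/andP: i0N.
    have -> : u' (size k1) m1 = 1%N by rewrite /u' !eqxx.
    congr (box_op _ _ _ _ _).
    apply: eq_diag_op => i j ij; rewrite /u'.
    by case: eqP ij => //= ->; rewrite nthka; case: eqP => // ->; rewrite ltnn.
  have -> : E i0 (kl_op E g n ka v) =
      (- g 1) *: kl_op E g n ka v + diag_op g E n ka' u' v.
    by rewrite -TE /box_op addrCA scaleNr addNr addr0.
  apply: (PL); first by apply: (PK).
  have -> : diag_op g E n ka' u' v =
      (diag_op g E n ka' u' v - kl_op E g n ka' v) + kl_op E g n ka' v.
    by rewrite subrK.
  apply: (PD); last by apply: (PK).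
  apply: (IH (sumn ka') (ltla _ szk' lek' nek') ka' erefl P) => //.
    split=> //; first by rewrite szk'.
    by apply: leq_trans hN; rewrite leq_add2l -!nth0.
  move=> mu pmu szmu lemu nemu; apply: (PK) => //; first by rewrite szmu.
    by move=> i; apply: leq_trans (lemu i) (lek' i).
  apply/eqP => h; have := sumn_lt szmu lemu nemu; rewrite h sE => lt_s.
  by have := ltn_trans lt_s (ltla _ szk' lek' nek'); rewrite ltnn.
(* the induction hypothesis for the preimage of P under the last box operator *)
have PT w u' : P (box_op g E i0 w (diag_op g E n mu0 u' v - kl_op E g n mu0 v)).
  apply: (IH (sumn mu0) (ltla _ szmu0 lemu0 ltmu0) mu0 erefl
             (fun x => P (box_op g E i0 w x))).
  - split=> //; first by rewrite szmu0.
    by apply: leq_trans hN; rewrite leq_add2l -!nth0.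
  - by rewrite (box_op0 _ heckeE).
  - by move=> a x y Px Py; rewrite (hecke_box_op_linear _ heckeE); apply: (PL).
  - move=> ka pka szka leka neka; apply: (PD).
      by apply: (PE) => //; rewrite szka.
    apply: (PZ); apply: (PK) => //; first by rewrite szka.
      by move=> i; apply: leq_trans (leka i) (lemu0 i).
    apply/eqP => h; have := leka (size l1).
    by rewrite h nthmu eqxx nthla ltnn.
(* both products add the last box to a product over mu0 *)
have split_box u' : diag_op g E n la u' v =
    box_op g E i0 (u' (size l1) m) (diag_op g E n mu0 u' v).
  by rewrite laE diag_op_add_box //; rewrite -/mu0; lia.
have u1 : klfill la (size l1) m = 1%N.
  rewrite /klfill laE drop_cat ltnn subnn drop0 klrow_corner //.
  by case: (l2) l20 => //= a l /andP[/eqP->].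
rewrite /kl_op !split_box u1.
set K := kl_op E g n mu0 v.
have T_split w u' : box_op g E i0 w (diag_op g E n mu0 u' v) =
    box_op g E i0 w (diag_op g E n mu0 u' v - K) + box_op g E i0 w K.
  rewrite -[X in _ = _ + X]scale1r addrC -(hecke_box_op_linear _ heckeE).
  by rewrite scale1r addrC subrK.
rewrite (T_split _ u) (T_split _ (klfill la)) opprD addrACA; apply: (PD).
  by apply: (PD) => //; rewrite -[X in P X]scaleN1r; apply: (PZ); apply: PT.
rewrite /box_op opprD addrACA subrr add0r -scalerBl; apply: (PZ).
by apply: (PK).
Qed.

End Triangularity.

(** * The spin chain *)

Section Spin.
Variables (C : fieldType) (t : C).

Notation functional := ((nat -> bool) -> C^o).
Implicit Types (w : nat -> bool) (phi : functional).

Definition ins_pair c a b w i : bool :=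
  if (i < c)%N then w i else if i == c then a else if i == c.+1 then b else w (i - 2)%N.

Definition del_pair c w i : bool := if (i < c)%N then w i else w i.+2.

(** Words are infinite, which avoids boundary effects; [true] is an up step.  The
    functionals are row vectors, so that [cup] and [cap] act on them by composition
    with the insertion of the singlet and with its contraction.  The coefficients
    1, - t and - t^-1, 1 give a loop the value tau and straighten a zigzag. *)
Definition cup c phi : functional :=
  fun w => phi (ins_pair c true false w) - t * phi (ins_pair c false true w).

Definition cap_weight (a b : bool) : C :=
  if a then (if b then 0 else - t^-1) else (if b then 1 else 0).

Definition cap c phi : functional :=
  fun w => cap_weight (w c) (w c.+1) * phi (del_pair c w).

Definition tlgen c phi := cap c (cup c phi).

Local Ltac words := apply: funext => i; rewrite /ins_pair /del_pair;
  do ?[case: ifP => ?]; first [by [] | by congr (_ _); lia | by exfalso; lia | lia | idtac].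

Lemma ins_far c d a b a' b' w :
  ins_pair (c.+2 + d) a b (ins_pair c a' b' w) =
  ins_pair c a' b' (ins_pair (c + d) a b w).
Proof. by words. Qed.

Lemma del_ins c a b w : del_pair c (ins_pair c a b w) = w.
Proof. words. Qed.

Lemma del_ins_right c b w : del_pair c.+1 (ins_pair c (w c) b w) = w.
Proof.
words.
Qed.

Lemma del_ins_left c a w : del_pair c (ins_pair c.+1 a (w c) w) = w.
Proof. words. Qed.

Lemma del_ins_far c d a b w :
  del_pair (c.+2 + d) (ins_pair c a b w) = ins_pair c a b (del_pair (c + d) w).
Proof. words. Qed.

Lemma del_ins_far2 c d a b w :
  del_pair c (ins_pair (c.+2 + d) a b w) = ins_pair (c + d) a b (del_pair c w).
Proof. words. Qed.

Lemma del_del c d w :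
  del_pair c (del_pair (c.+2 + d) w) = del_pair (c + d) (del_pair c w).
Proof. words. Qed.

Lemma ins_at c a b w : (ins_pair c a b w c = a) * (ins_pair c a b w c.+1 = b).
Proof.
by split; rewrite /ins_pair ?ltnn ?eqxx // ltnNge leqnSn /= gtn_eqF.
Qed.

Lemma ins_before c a b w i : (i < c)%N -> ins_pair c a b w i = w i.
Proof. by rewrite /ins_pair => ->. Qed.

Lemma ins_after c a b w i : ins_pair c a b w (c.+2 + i) = w (c + i)%N.
Proof.
rewrite /ins_pair; do ?[case: ifP => ?]; try lia.
by congr (w _); lia.
Qed.

Lemma del_before c w i : (i < c)%N -> del_pair c w i = w i.
Proof. by rewrite /del_pair => ->. Qed.

Lemma del_after c w i : del_pair c w (c + i) = w (c.+2 + i)%N.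
Proof. by rewrite /del_pair ltnNge leq_addr. Qed.

Local Notation tau := (- (t + t^-1)).

Lemma cup_linear c : linear (cup c).
Proof.
move=> a phi psi; apply: funext => w; rewrite /cup /=.
rewrite -[LHS]/((a * phi _ + psi _) - t * (a * phi _ + psi _)).
rewrite -[RHS]/(a * (phi _ - t * phi _) + (psi _ - t * psi _)).
by ring.
Qed.

Lemma cap_linear c : linear (cap c).
Proof.
move=> a phi psi; apply: funext => w; rewrite /cap /=.
rewrite -[LHS]/(cap_weight _ _ * (a * phi _ + psi _)).
rewrite -[RHS]/(a * (cap_weight _ _ * phi _) + (cap_weight _ _ * psi _)).
by ring.
Qed.

Lemma cap0 c : cap c 0 = 0.
Proof. by apply: funext => w; rewrite /cap mulr0. Qed.

Lemma tlgen_linear c : linear (tlgen c).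
Proof. by move=> a x y; rewrite /tlgen cup_linear cap_linear. Qed.

Lemma cup_cap c phi : cup c (cap c phi) = tau *: phi.
Proof.
apply: funext => w; rewrite /cup /cap !ins_at !del_ins /cap_weight.
by rewrite -[RHS]/(tau * phi w); ring.
Qed.

Lemma cup_cup c d phi : cup c (cup (c.+2 + d) phi) = cup (c + d) (cup c phi).
Proof. by apply: funext => w; rewrite /cup !ins_far; ring. Qed.

Lemma cup_cap_far c d phi : cup c (cap (c.+2 + d) phi) = cap (c + d) (cup c phi).
Proof.
apply: funext => w; rewrite /cup /cap !del_ins_far.
by rewrite -!addnS !ins_after; ring.
Qed.

Lemma cup_cap_far2 c d phi : cup (c.+2 + d) (cap c phi) = cap c (cup (c + d) phi).
Proof.
apply: funext => w; rewrite /cup /cap !del_ins_far2.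
by rewrite !ins_before; [ring| lia..].
Qed.

Lemma cap_cap c d phi : cap (c.+2 + d) (cap c phi) = cap c (cap (c + d) phi).
Proof.
apply: funext => w; rewrite /cap del_del.
rewrite -!addnS !del_after !del_before; [|lia..].
by rewrite !addnS mulrCA.
Qed.

Lemma cup_tlgen c phi : cup c (tlgen c phi) = tau *: cup c phi.
Proof. exact: cup_cap. Qed.

Lemma cup_tlgen_above c k phi : (c.+1 < k)%N ->
  cup c (tlgen k phi) = tlgen (k - 2) (cup c phi).
Proof.
move=> ck; have [d ->] : exists d, k = (c.+2 + d)%N by exists (k - c.+2)%N; lia.
by rewrite /tlgen cup_cap_far cup_cup (_ : c.+2 + d - 2 = c + d)%N //; lia.
Qed.

Lemma cup_tlgen_below c k phi : (k.+1 < c)%N -> cup c (tlgen k phi) = tlgen k (cup c phi).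
Proof.
move=> ck; have [d ->] : exists d, c = (k.+2 + d)%N by exists (c - k.+2)%N; lia.
by rewrite /tlgen cup_cap_far2 cup_cup.
Qed.

Lemma tlgen_comm k l phi : (k.+1 < l)%N -> tlgen k (tlgen l phi) = tlgen l (tlgen k phi).
Proof.
move=> kl; rewrite {1}/tlgen cup_tlgen_above //.
have [d ->] : exists d, l = (k.+2 + d)%N by exists (l - k.+2)%N; lia.
rewrite (_ : k.+2 + d - 2 = k + d)%N; last by lia.
by rewrite /tlgen cup_cap_far2 cap_cap -cup_cup.
Qed.

(** The indicator of the word with ups at the positions 0, ..., n.  Position 0 is
    a spectator, since the indices k are positive. *)
Definition step_word n : functional := fun w => (`[< forall i, w i = (i <= n)%N >])%:R.

Lemma cup_step n k : k != n -> cup k (step_word n) = 0.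
Proof.
move=> kn; apply: funext => w; rewrite /cup /step_word.
rewrite !asboolF ?mulr0 ?subr0 // => H.
  by have := H k; have := H k.+1; rewrite !ins_at; lia.
by have := H k; have := H k.+1; rewrite !ins_at; lia.
Qed.

Lemma cup_stepS n : cup n.+1 (step_word n.+1) = step_word n.
Proof.
apply: funext => w; rewrite /cup /step_word.
rewrite [X in _ - t * (nat_of_bool X)%:R]asboolF ?mulr0 ?subr0; last first.
  by move=> /(_ n.+1); rewrite ins_at leqnn.
congr (nat_of_bool _)%:R; apply: asbool_equiv_eq; split=> H i.
  case: (ltnP i n.+1) => h; first by rewrite -(ins_before true false w h) H; lia.
  have [d ->] : exists d, i = (n.+1 + d)%N by exists (i - n.+1)%N; lia.
  by rewrite -(ins_after n.+1 true false w) H; lia.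
rewrite /ins_pair; case: ifP => h1; first by rewrite H; lia.
case: ifP => h2; first by move/eqP: h2 => ->; rewrite leqnn.
by case: ifP => h3; [lia|rewrite H; lia].
Qed.

Lemma tlgen_step n k : k != n -> tlgen k (step_word n) = 0.
Proof.
by move=> kn; rewrite /tlgen cup_step // cap0.
Qed.

Hypothesis t_neq0 : t != 0.

Lemma cup_cap_right c phi : cup c (cap c.+1 phi) = phi.
Proof.
apply: funext => w; rewrite /cup /cap !ins_at.
have e0 a b : ins_pair c a b w c.+2 = w c.
  by have := ins_after c a b w 0; rewrite !addn0.
rewrite !e0; by case: (w c) (@del_ins_right c false w) (@del_ins_right c true w) => e1 e2;
  rewrite /cap_weight /= ?e1 ?e2 mul0r ?mul1r ?mulr0 ?subr0 // mulNr mulrN opprK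
    add0r mulVKf.
Qed.

Lemma cup_cap_left c phi : cup c.+1 (cap c phi) = phi.
Proof.
apply: funext => w; rewrite /cup /cap !ins_at !(ins_before _ _ _ (ltnSn c)).
by case: (w c) (@del_ins_left c false w) (@del_ins_left c true w) => e1 e2;
  rewrite /cap_weight /= ?e1 ?e2 mul0r ?mul1r ?mulr0 ?subr0 // mulNr mulrN opprK
    add0r mulVKf.
Qed.

Lemma cup_tlgen_right c phi : cup c (tlgen c.+1 phi) = cup c.+1 phi.
Proof. exact: cup_cap_right. Qed.

Lemma cup_tlgen_left c phi : cup c.+1 (tlgen c phi) = cup c phi.
Proof. exact: cup_cap_left. Qed.

Lemma tlgen_hecke N : hecke_module tau N tlgen.
Proof.
have arc3 k phi : tlgen k (tlgen k.+1 (tlgen k phi)) = tlgen k phi.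
  by rewrite {1 2}/tlgen cup_tlgen_left cup_cap_right.
have arc3' k phi : tlgen k.+1 (tlgen k (tlgen k.+1 phi)) = tlgen k.+1 phi.
  by rewrite {1 2}/tlgen cup_tlgen_right cup_cap_left.
split.
- exact: tlgen_linear.
- move=> k x _; rewrite {1}/tlgen cup_tlgen.
  by rewrite -[tau *: _]addr0 cap_linear cap0 addr0.
- by move=> k l x _ kl _; apply: tlgen_comm.
- by move=> k x _ _; rewrite arc3 arc3' !subrr.
Qed.

End Spin.

(** * Valleys of the boundary path *)

Lemma klrow_le la j M :
  (forall i, (j < nth 0 la i)%N -> (i + nth 0 la i <= M + j)%N) -> (klrow la j <= M)%N.
Proof.
elim: la M => //= m la IH M H; rewrite /klrow_step; case: ifP => // jm.
have := H 0%N jm; rewrite /= add0n => mM.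
case: M H mM => [|M] H mM; first by lia.
rewrite geq_max ltnS IH => [|i ji]; first by rewrite /=; lia.
by have := H i.+1 ji; rewrite /=; lia.
Qed.

Lemma klrow_ge la j i : (forall i', (i' <= i)%N -> (j < nth 0 la i')%N) ->
  (i + (nth 0 la i - j) <= klrow la j)%N.
Proof.
elim: la i => [|m la IH] i H; first by have := H i (leqnn i); rewrite nth_nil.
have jm : (j < m)%N := H 0%N (leq0n i).
rewrite /= /klrow_step jm; case: i H => [|i] H /=; first by rewrite leq_max leqnn orbT.
have := IH i (fun i' => H i'.+1); lia.
Qed.

(** The rectangle of r rows and j0 columns lies in la, and no row of la ends on a later
    antidiagonal than the rectangle: on the boundary path its corner is a lowest
    valley. *)
Definition is_valley (la : seq nat) (r j0 : nat) : Prop :=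
  [/\ forall i, (i < r)%N -> (j0 <= nth 0 la i)%N
    & forall i, (0 < nth 0 la i)%N -> (i + nth 0 la i < r + j0)%N].

(** Over a lowest valley the longest chain of boxes from any box of the rectangle ends at
    its corner, so the filling restricts to that of the rectangle. *)
Lemma klrow_valley la r j0 j : is_valley la r j0 -> (0 < r)%N -> (j < j0)%N ->
  klrow la j = (r.-1 + (j0 - j))%N.
Proof.
move=> [H1 H2] r0 jj0; apply/eqP; rewrite eqn_leq; apply/andP; split.
  by apply: klrow_le => i ji; have := H2 i; lia.
have hr : (r.-1 < r)%N by lia.
have := H1 _ hr.
have /klrow_ge : forall i', (i' <= r.-1)%N -> (j < nth 0 la i')%N.
  by move=> i' hi; apply: leq_trans jj0 (H1 _ _); lia.
lia.
Qed.

Lemma klfill_valley la r j0 i j : is_valley la r j0 -> (i < r)%N -> (j < j0)%N ->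
  klfill la i j = (r - i.+1 + (j0 - j))%N.
Proof.
move=> [H1 H2] ir jj0; rewrite subnS; apply: klrow_valley => //; last by lia.
split=> i'; rewrite nth_drop => hi; first by apply: H1; lia.
by have := H2 _ hi; lia.
Qed.

Lemma klfill_nseq r j0 i j : (i < r)%N -> (j < j0)%N ->
  klfill (nseq r j0) i j = (r - i.+1 + (j0 - j))%N.
Proof.
apply: klfill_valley; split=> i' hi; first by rewrite nth_nseq hi.
by move: hi; rewrite nth_nseq; case: ifP => //; lia.
Qed.

Lemma klrow_shift s b j0 j : (head 0 b <= j0)%N ->
  klrow (s ++ b) (j0 + j) = klrow (map (subn^~ j0) s) j.
Proof.
move=> hb; elim: s => [|m s IH] /=; first by rewrite klrow_out //; lia.
rewrite /klrow_step IH; do 2!case: ifP; lia.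
Qed.

Lemma valley_exists la : pairwise geq la -> (0 < head 0 la)%N ->
  exists s b j0, [/\ la = s ++ b, (0 < size s)%N, (0 < j0)%N,
    (head 0 b < j0)%N & is_valley la (size s) j0].
Proof.
elim: la => //= m la IH /andP[mla pla] m0.
case: (posnP (head 0%N la)) => h0.
  exists [:: m], la, m; rewrite h0; split=> //.
  split=> [[|i]|[|i]] //=; have := pairwise_geq_nth i pla; lia.
have [s [b [j0 [laE s0 j00 hb [H1 H2]]]]] := IH pla h0.
have hm : (head 0 la <= m)%N by case: (la) mla => //= a l /andP[].
case: (ltnP m ((size s).+1 + j0)) => hmr.
  exists (m :: s), b, j0; rewrite laE; split=> //; split=> [[|i]|[|i]] //=.
  - by move=> _; apply: leq_trans (H1 0%N s0) _; rewrite nth0.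
  - by move=> hi; rewrite -laE; apply: H1.
  - by rewrite -laE => /H2; lia.
exists [:: m], la, m; split=> //.
  by move: h0; rewrite -nth0 => /H2; lia.
split=> [[|i]|[|i]] //=.
by move=> /H2; lia.
Qed.

Lemma nth_delete l1 m l2 i :
  nth 0%N (map predn l1 ++ l2) i =
  if (i < size l1)%N then (nth 0%N (l1 ++ m :: l2) i).-1 else nth 0%N (l1 ++ m :: l2) i.+1.
Proof.
rewrite !nth_cat size_map; case: ltnP => h; first by rewrite (nth_map 0%N).
by rewrite ltnNge (leqW h) /= subSn.
Qed.

Lemma map_pred_sub j0 s : (map (subn^~ j0) (map predn s) = map predn (map (subn^~ j0) s)).
Proof. by rewrite -!map_comp; apply: eq_map => i /=; lia. Qed.

Lemma pairwise_geq_map_sub j (l : seq nat) :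
  pairwise geq l -> pairwise geq (map (subn^~ j) l).
Proof.
rewrite pairwise_map; apply: sub_pairwise => a b /=; lia.
Qed.

Lemma pairwise_geq_delete l1 m l2 : pairwise geq (l1 ++ m :: l2) -> all (ltn m) l1 ->
  pairwise geq (map predn l1 ++ l2).
Proof.
move=> /pairwise_geqP pla ml1; apply/pairwise_geqP => i j ij.
have nthm : nth 0%N (l1 ++ m :: l2) (size l1) = m by rewrite nth_cat ltnn subnn.
have nth_l1 k : (k < size l1)%N -> (m < nth 0 (l1 ++ m :: l2) k)%N.
  by move=> kl; rewrite nth_cat kl; apply: (allP ml1); rewrite mem_nth.
rewrite !(nth_delete _ m); case: (ltnP j (size l1)) => jl.
  by rewrite (leq_ltn_trans ij jl) -!subn1 leq_sub2r // pla.
case: (ltnP i (size l1)) => il; last exact: pla.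
have := pla _ _ (leqW jl); have := nth_l1 i il; rewrite nthm; lia.
Qed.

Lemma nseq_not_peak n r j0 k : (r <= n)%N -> k != (n + j0)%N -> ~ is_peak n (nseq r j0) k.
Proof.
move=> rn kn [l1 [m [l2 [E12 hl1 kE]]]].
have mj : m = j0.
  have /nseqP[] // : m \in nseq r j0 by rewrite E12 mem_cat inE eqxx orbT.
case: l1 E12 hl1 kE => [|a l1] E12 /=.
  by rewrite subn0 mj => _ /eqP; rewrite (negbTE kn).
have /nseqP[-> _] : a \in nseq r j0 by rewrite E12 inE eqxx.
by rewrite mj ltnn.
Qed.

(** * Closing a peak by a cup *)

Section SpinDiagrams.
Variables (C : fieldType) (t : C) (g : nat -> C).

Notation functional := ((nat -> bool) -> C^o).
Notation E := (tlgen t).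
Notation T := (box_op g E).
Notation row := (row_op g E).
Notation diag := (diag_op g E).
Notation kl := (kl_op E g).
Implicit Types (phi x y : functional).

Lemma tlgen_box_op_comm k l u v x : (k.+1 < l)%N -> T k u (T l v x) = T l v (T k u x).
Proof.
move=> kl; apply: (@box_op_morph _ g _ _ (T k u)).
  by apply: box_op_linear; apply: tlgen_linear.
apply/esym/(@box_op_morph _ g _ _ (E l)); first exact: tlgen_linear.
exact/esym/tlgen_comm.
Qed.

Lemma cup0 c : cup t c 0 = 0.
Proof.
apply: (addrI (cup t c 0)); rewrite addr0 -[X in X + _]scale1r -cup_linear.
by rewrite scaler0 addr0.
Qed.

Lemma cup_box_op_above c k u phi : (c.+1 < k)%N ->
  cup t c (T k u phi) = T (k - 2) u (cup t c phi).
Proof.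
by move=> ck; apply: box_op_morph; [exact: cup_linear | exact: cup_tlgen_above].
Qed.

Lemma cup_box_op_below c k u phi : (k.+1 < c)%N ->
  cup t c (T k u phi) = T k u (cup t c phi).
Proof.
by move=> ck; apply: box_op_morph; [exact: cup_linear | exact: cup_tlgen_below].
Qed.

Lemma cup_diag_below c n la u phi :
  (forall i j, (j < nth 0 la i)%N -> ((n - i + j).+1 < c)%N) ->
  cup t c (diag n la u phi) = diag n la u (cup t c phi).
Proof.
move=> H; apply: (diag_op_morph (F := cup t c)) => i j y ij.
by apply: cup_box_op_below; apply: H.
Qed.

Lemma cup_diag_above c n la u phi :
  (forall i j, (j < nth 0 la i)%N -> (i.+1 < n)%N && (c.+1 < n - i + j)%N) ->
  cup t c (diag n la u phi) = diag (n - 2) la u (cup t c phi).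
Proof.
move=> H; apply: (diag_op_morph (F := cup t c)) => i j y ij.
have /andP[h1 h2] := H i j ij.
by rewrite cup_box_op_above // (_ : n - i + j - 2 = n - 2 - i + j)%N //; lia.
Qed.

Lemma diag_swap n1 s1 u1 n2 s2 u2 x :
  (forall i j i' j', (j < nth 0 s1 i)%N -> (j' < nth 0 s2 i')%N ->
     ((n1 - i + j).+1 < n2 - i' + j')%N) ->
  diag n1 s1 u1 (diag n2 s2 u2 x) = diag n2 s2 u2 (diag n1 s1 u1 x).
Proof.
move=> H; apply: (diag_op_morph (F := diag n1 s1 u1)) => i' j' y h'.
apply/esym; apply: (diag_op_morph (F := T (n2 - i' + j') (u2 i' j'))) => i j z h.
exact/esym/tlgen_box_op_comm/H.
Qed.

Lemma cup_kl_below c n la phi :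
  (forall i j, (j < nth 0 la i)%N -> ((n - i + j).+1 < c)%N) ->
  cup t c (kl n la phi) = kl n la (cup t c phi).
Proof. exact: cup_diag_below. Qed.

Lemma cup_kl_above c n la phi :
  (forall i j, (j < nth 0 la i)%N -> (i.+1 < n)%N && (c.+1 < n - i + j)%N) ->
  cup t c (kl n la phi) = kl (n - 2) la (cup t c phi).
Proof. exact: cup_diag_above. Qed.

Lemma kl_swap n1 s1 n2 s2 x :
  (forall i j i' j', (j < nth 0 s1 i)%N -> (j' < nth 0 s2 i')%N ->
     ((n1 - i + j).+1 < n2 - i' + j')%N) ->
  kl n1 s1 (kl n2 s2 x) = kl n2 s2 (kl n1 s1 x).
Proof. exact: diag_swap. Qed.

Lemma diag_split_columns n s j0 u x : all (leq j0) s -> (size s <= n)%N ->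
  diag n s u x =
  diag (n + j0) (map (subn^~ j0) s) (fun i j => u i (j0 + j)%N)
    (diag n (nseq (size s) j0) u x).
Proof.
elim: s n u x => //= m s IH n u x /andP[jm js] sn.
rewrite IH //; last by lia.
rewrite -{1}(subnKC jm) row_op_split (_ : (n + j0).-1 = n.-1 + j0)%N; last by lia.
congr diag; apply: (@diag_swap _ _ _ _ [:: (m - j0)%N] (fun=> fun j => u 0%N (j0 + j)%N)).
move=> i j [|i'] j' /=; last by rewrite nth_nil.
by rewrite nth_nseq; case: ifP => // ir; lia.
Qed.

(** The boxes right of the rectangle and the boxes below it have distant indices, so the
    product can be taken over the rectangle first. *)
Lemma kl_op_valley n s b j0 x : (size s <= n)%N ->
  is_valley (s ++ b) (size s) j0 -> (head 0 b <= j0)%N ->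
  kl n (s ++ b) x =
  kl (n - size s) b (kl (n + j0) (map (subn^~ j0) s) (kl n (nseq (size s) j0) x)).
Proof.
move=> sn [H1 H2] hb; rewrite kl_op_cat (@diag_split_columns n s j0) //; last first.
  apply/allP => y /(nthP 0%N)[i si <-].
  by have := H1 i si; rewrite nth_cat si.
congr kl; rewrite /kl_op.
have -> : diag n (nseq (size s) j0) (klfill (s ++ b)) x =
          diag n (nseq (size s) j0) (klfill (nseq (size s) j0)) x.
  apply: eq_diag_op => i j; rewrite nth_nseq; case: ifP => // ir jj0.
  by rewrite klfill_nseq // (@klfill_valley _ (size s) j0).
apply: eq_diag_op => i j.
case: (ltnP i (size s)) => [ir _|ir]; last by rewrite nth_default ?size_map.
by rewrite /klfill drop_cat ir klrow_shift // map_drop.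
Qed.

Lemma kl_op_zeros n la x : all (pred1 0%N) la -> kl n la x = x.
Proof. exact: diag_op_zeros. Qed.

End SpinDiagrams.

Section LinkPatterns.
Variables (C : fieldType) (t : C).
Hypothesis t_neq0 : t != 0.
Notation tau := (- (t + t^-1)).
Hypothesis tau_neq0 : tau != 0.
Variable g : nat -> C.
Hypothesis baxterg : baxter_weight tau g.

Notation functional := ((nat -> bool) -> C^o).
Notation E := (tlgen t).
Notation T := (box_op g E).
Notation row := (row_op g E).
Notation diag := (diag_op g E).
Notation kl := (kl_op E g).
Implicit Types (phi x y : functional).

Let heckeE N : hecke_module tau N E := tlgen_hecke t_neq0 N.

Lemma row_zero B u m : row B u m (0 : functional) = 0.
Proof. exact: (row_op0 g (heckeE 0)). Qed.

Lemma cup_killed c phi : E c phi = 0 -> cup t c phi = 0.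
Proof.
move=> h; have := cup_tlgen t c phi; rewrite h cup0 => /esym/eqP.
by rewrite scaler_eq0 (negbTE tau_neq0) => /eqP.
Qed.

(** Each box operator is E plus a scalar.  The E terms slide the cup to the left, one
    step per box, by the zigzag relation; the scalar terms vanish because the cup
    then meets a functional that E kills. *)
Lemma cup_row B u m phi :
  (forall k, (B < k <= B + m)%N -> E k phi = 0) ->
  cup t (B + m) (row B u m phi) = cup t B phi.
Proof.
elim: m => [|m IH] H; first by rewrite addn0.
rewrite /= /box_op addrC cup_linear addnS cup_tlgen_left // IH; last first.
  by move=> k hk; apply: H; lia.
have -> : cup t (B + m).+1 (row B u m phi) = row B u m (cup t (B + m).+1 phi).
  apply: (row_op_morph (F := cup t (B + m).+1)) => j y jm.
  by apply: cup_box_op_below; lia.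
rewrite (@cup_killed (B + m).+1 phi) ?row_zero ?scaler0 ?add0r //.
by apply: H; lia.
Qed.

Lemma cup_rect_top n r j0 u phi : (r < n)%N ->
  (forall k, (n < k <= n + j0)%N -> E k phi = 0) ->
  cup t (n + j0) (diag n (nseq r.+1 j0) u phi) =
  diag n.-1 (nseq r j0) (fun i => u i.+1) (cup t n phi).
Proof.
move=> rn H /=; rewrite cup_diag_below; first by rewrite cup_row.
by move=> i j; rewrite nth_nseq; case: ifP => // ir; lia.
Qed.

Lemma cup_rect_left n r j0 u phi : (r < n)%N ->
  (forall k, (n - r <= k < n)%N -> E k phi = 0) ->
  cup t (n - r) (diag n (nseq r j0.+1) u phi) =
  diag n.-1 (nseq r j0) (fun i j => u i j.+1) (cup t n phi).
Proof.
elim: r n u phi => [|r IH] n u phi rn H; first by rewrite subn0.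
have n1 : (0 < n)%N by lia.
have -> : diag n (nseq r.+1 j0.+1) u phi =
  diag n.-1 (nseq r j0.+1) (fun i => u i.+1) (row n (u 0%N) j0.+1 phi) by [].
rewrite -subn_pred IH; try lia; last first.
  move=> k hk; rewrite (hecke_row_comm _ (heckeE (n + j0).+1)) ?H ?row_zero //; lia.
rewrite [RHS]/=; congr diag.
have [n' nE] : exists n', n = n'.+1 by exists n.-1; lia.
rewrite nE succnK -[j0.+1]add1n row_op_split /= addn0 addn1.
have -> : cup t n' (row n'.+2 (fun j => u 0%N j.+1) j0 (T n'.+1 (u 0%N 0%N) phi)) =
          row n' (fun j => u 0%N j.+1) j0 (cup t n' (T n'.+1 (u 0%N 0%N) phi)).
  apply: (row_op_morph (F := cup t n')) => j y jm.
  by rewrite cup_box_op_above; [congr (box_op _ _ _ _ _); lia|lia].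
congr row_op; rewrite /box_op addrC cup_linear cup_tlgen_right //.
by rewrite (@cup_killed n' phi) ?scaler0 ?add0r //; apply: H; lia.
Qed.

Lemma kl_rect_kill n r j0 k M x : (r <= n)%N -> (k <= M)%N -> (n + j0 <= M.+1)%N ->
  (forall l, (n - r < l <= M)%N -> l != n -> E l x = 0) ->
  (n - r < k)%N -> k != (n + j0)%N -> E k (kl n (nseq r j0) x) = 0.
Proof.
move=> rn kM nM H k0 kn.
apply: (kl_op_nonpeak (heckeE M.+1) baxterg); rewrite ?size_nseq //.
- apply/(pairwiseP 0%N) => i j; rewrite !inE size_nseq => hi hj _.
  by rewrite !nth_nseq hi hj /=.
- by case: (r) => //=; lia.
- by apply/andP.
- exact: nseq_not_peak.
Qed.

(** Choose a rectangle at a lowest valley: la is the rectangle, a part to its right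
    and a part below it.  The peak belongs to one of the two parts.  The rectangle
    applied to phi is killed by all E_k except at its own two peaks, which is the
    hypothesis needed to apply the induction to that part; the cup moves to the
    corresponding peak of the rectangle and through its first row or column. *)
Lemma kl_cup_peak la l1 m l2 n phi : la = l1 ++ m :: l2 -> pairwise geq la ->
  all (ltn m) l1 -> (size la <= n)%N ->
  (forall k, (n - size la < k <= n + head 0 la)%N -> k != n -> E k phi = 0) ->
  cup t (n - size l1 + m) (kl n la phi) =
  kl n.-1 (map predn l1 ++ l2) (cup t n phi).
Proof.
have [s] := ubnP (size la + head 0 la)%N.
elim: s => // s IH in la l1 m l2 n phi *.
rewrite ltnS => sE /esym laE pla ml1 szn Hphi.
have szE : size la = (size l1 + (size l2).+1)%N by rewrite -laE size_cat.
have nthla i : (nth 0 la i <= head 0 la)%N := pairwise_geq_nth i pla.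
have nthm : nth 0%N la (size l1) = m by rewrite -laE nth_cat ltnn subnn.
have nth_l1 i : (i < size l1)%N -> (m < nth 0 la i)%N.
  by move=> il; rewrite -laE nth_cat il; apply: (allP ml1); rewrite mem_nth.
case: (posnP (head 0%N la)) => h0.
  have la0 : all (pred1 0%N) la.
    by apply/(all_nthP 0%N) => i _ /=; have := nthla i; rewrite h0 leqn0.
  have l10 : l1 = [::].
    case: (l1) nth_l1 => // a l /(_ 0%N (ltn0Sn _)).
    by have := nthla 0%N; lia.
  have m0 : m = 0%N by have := nthla (size l1); lia.
  rewrite kl_op_zeros // l10 m0 subn0 addn0 kl_op_zeros //=.
  by move: la0; rewrite -laE l10 /= => /andP[].
have [tp [b [j0 [laE2 s0 j00 hb valley]]]] := valley_exists pla h0.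
have [V1 V2] := valley.
have j0h : (j0 <= head 0 la)%N := leq_trans (V1 0%N s0) (nthla 0%N).
have szE2 : size la = (size tp + size b)%N by rewrite laE2 size_cat.
have sn : (size tp <= n)%N by lia.
have ptp : pairwise geq tp by move: pla; rewrite laE2 pairwise_cat => /and3P[].
have pb : pairwise geq b by move: pla; rewrite laE2 pairwise_cat => /and3P[].
have nthb i : (nth 0 b i <= head 0 b)%N := pairwise_geq_nth i pb.
have headtp : head 0%N tp = head 0%N la by rewrite laE2; case: (tp) s0.
have nth_delete' i := nth_delete l1 m l2 i.
rewrite laE in nth_delete'.
rewrite laE2 (@kl_op_valley _ t g n tp b j0) -?laE2 //; last by lia.
set psi := kl n (nseq (size tp) j0) phi.
have psi_kill k : (n - size tp < k <= n + head 0 la)%N -> k != (n + j0)%N ->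
    E k psi = 0.
  move=> /andP[k1 k2] kn; apply: (kl_rect_kill sn k2) => //.
    by lia.
  by move=> l hl ln; apply: Hphi => //; lia.
have map_sub j (l : seq nat) i : nth 0%N (map (subn^~ j) l) i = (nth 0%N l i - j)%N.
  case: (ltnP i (size l)) => h; first by rewrite (nth_map 0%N).
  by rewrite !nth_default ?size_map.
(* R is the part right of the rectangle, b the part below it *)
pose R := map (subn^~ j0) tp.
have szR : size R = size tp by rewrite size_map.
have headR : head 0%N R = (head 0%N la - j0)%N by rewrite -headtp /R; case: (tp).
have nthR i : nth 0%N R i = (nth 0%N tp i - j0)%N by apply: map_sub.
case: (ltnP (size l1) (size tp)) => hl.
  (* the peak lies right of the valley *)
  pose l2a := drop (size l1).+1 tp.
  have tpE : tp = l1 ++ m :: l2a.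
    have -> : l1 = take (size l1) tp.
      by rewrite -[LHS](take_size_cat (m :: l2) erefl) laE laE2 takel_cat // ltnW.
    have -> : m = nth 0%N tp (size (take (size l1) tp)).
      by rewrite size_takel ?(ltnW hl) // -nthm laE2 nth_cat hl.
    by rewrite size_takel ?(ltnW hl) // /l2a -drop_nth // cat_take_drop.
  have l2E : l2 = l2a ++ b.
    move: laE; rewrite laE2 tpE -catA /= => /eqP.
    by rewrite eqseq_cat // eqxx /= eqseq_cons eqxx => /eqP.
  have mj0 : (j0 <= m)%N by rewrite -nthm; apply: V1.
  rewrite cup_kl_below; last first.
    by move=> i j ij; have := nthb i; lia.
  have -> : (n - size l1 + m = (n + j0) - size (map (subn^~ j0) l1) + (m - j0))%N.
    by rewrite size_map; lia.
  have RE : R = map (subn^~ j0) l1 ++ (m - j0)%N :: map (subn^~ j0) l2a.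
    by rewrite /R tpE map_cat.
  rewrite (IH R _ _ (map (subn^~ j0) l2a)) //; first last.
  - move=> k; rewrite szR headR => hk kn; apply: psi_kill => //; lia.
  - by rewrite szR; lia.
  - by rewrite all_map; apply: sub_all ml1 => a /=; lia.
  - exact: pairwise_geq_map_sub.
  - by rewrite szR headR; lia.
  have [r rE] : exists r, size tp = r.+1 by exists (size tp).-1; lia.
  rewrite /psi rE {1}/kl_op cup_rect_top; first last.
  - by move=> k hk; apply: Hphi; lia.
  - by lia.
  pose tp' := map predn l1 ++ l2a.
  have sztp' : size tp' = r.
    by move: rE; rewrite tpE /tp' !size_cat size_map /=; lia.
  rewrite l2E catA -/tp' (@kl_op_valley _ t g n.-1 tp' b j0); first last.
  - exact: ltnW.
  - rewrite -catA -l2E; split=> i; rewrite nth_delete' sztp'; case: (ltnP i (size l1)) => il hi.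
    + by have := nth_l1 i il; lia.
    + by apply: V1; lia.
    + by have := V2 i; lia.
    + by have := V2 i.+1 hi; lia.
  - by rewrite sztp'; lia.
  rewrite sztp' /tp' map_cat map_pred_sub.
  by congr kl; [lia|congr kl; lia].
(* the peak lies left of the valley *)
pose l1b := drop (size tp) l1.
have l1E : l1 = tp ++ l1b.
  rewrite -{1}(cat_take_drop (size tp) l1); congr (_ ++ _).
  by have := take_size_cat b (erefl (size tp)); rewrite -laE2 -laE takel_cat.
have bE : b = l1b ++ m :: l2.
  move: laE; rewrite laE2 l1E -catA => /eqP.
  by rewrite eqseq_cat // eqxx /= => /eqP.
have szl1 : size l1 = (size tp + size l1b)%N by rewrite l1E size_cat.
have mj0 : (m < j0)%N.
  by apply: leq_ltn_trans hb; have := nthb (size l1b); rewrite bE nth_cat ltnn subnn.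
have hR i j : (j < nth 0 R i)%N -> (i.+1 < size tp)%N.
  rewrite nthR => ij; have ir : (i < size tp)%N.
    by case: (ltnP i (size tp)) ij => // /(nth_default 0%N)->.
  by have := V2 i; rewrite laE2 nth_cat ir; lia.
rewrite kl_swap; last first.
  by move=> i j i' j' ij ij'; have := nthb i; have := hR _ _ ij'; lia.
rewrite cup_kl_above; last first.
  by move=> i j ij; have := hR _ _ ij; lia.
rewrite szl1 subnDA (IH b l1b m l2) //; first last.
- move=> k hk kn; case: (ltnP (n - size tp) k) => hk2.
    by apply: psi_kill; lia.
  rewrite /psi /kl_op (hecke_diag_comm _ (heckeE (n + j0).+1)).
  + by rewrite Hphi ?(diag_op0 _ (heckeE 0)) //; lia.
  + by lia.
  + by move=> i j; rewrite nth_nseq; case: ifP => // ir ij; lia.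
- by lia.
- by move: ml1; rewrite l1E all_cat => /andP[].
- by lia.
have [j jE] : exists j, j0 = j.+1 by exists j0.-1; lia.
rewrite /psi jE {1}/kl_op cup_rect_left; first last.
- by move=> k hk; apply: Hphi; lia.
- by lia.
have -> : diag n.-1 (nseq (size tp) j) (fun i k => klfill (nseq (size tp) j.+1) i k.+1)
     (cup t n phi) = kl n.-1 (nseq (size tp) j) (cup t n phi).
  apply: eq_diag_op => i k; rewrite nth_nseq; case: ifP => // ir kj.
  by rewrite !klfill_nseq.
rewrite l1E map_cat -catA (@kl_op_valley _ t g n.-1 _ _ j) ?size_map; first last.
- case: (l1b) bE => [|a l] bE /=.
    by case: (l2) bE => [|m2 l3] bE //=; have := nthb 1%N; rewrite bE /=; lia.
  by move: hb; rewrite bE /=; lia.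
- rewrite catA -map_cat -l1E; split=> i; rewrite nth_delete'; case: (ltnP i (size l1)) => il hi.
  + by have := V1 i hi; lia.
  + by lia.
  + by have := V2 i; lia.
  + by have := V2 i.+1 hi; lia.
- by lia.
have -> : map (subn^~ j) (map predn tp) = R.
  by rewrite /R -map_comp; apply: eq_map => i /=; lia.
rewrite [RHS]kl_swap; first last.
  move=> i k i' k' ik ik'; have := hR _ _ ik'.
  suff : (nth 0 (map predn l1b ++ l2) i <= j)%N by lia.
  rewrite (nth_delete _ m) -bE; have := nthb i; have := nthb i.+1.
  by case: ifP => _; lia.
by congr kl; [lia|rewrite /R jE|congr kl; lia].
Qed.

(** * Link patterns and the dual basis *)

(** The value at the link pattern of the Dyck path of mu.  Its arcs can be closed from
    the inside; the last up step, that of the first row, is followed by a down and is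
    closed first.  The word left at the end has no up besides position 0. *)
Fixpoint link_eval (mu : seq nat) phi : C :=
  if mu is m :: mu' then link_eval mu' (cup t (size mu + m) phi)
  else phi (fun i => i <= 0)%N.

Lemma link_eval_linear mu a x y :
  link_eval mu (a *: x + y) = a * link_eval mu x + link_eval mu y.
Proof. by elim: mu x y => //= m mu IH x y; rewrite cup_linear IH. Qed.

Lemma link_eval0 mu : link_eval mu 0 = 0.
Proof. by have := link_eval_linear mu (-1) 0 0; rewrite addr0 scaler0 mulN1r addNr. Qed.

Lemma link_eval_kl la mu : pairwise geq la -> pairwise geq mu -> size la = size mu ->
  link_eval mu (kl (size la) la (step_word C (size la))) = (la == mu)%:R.
Proof.
elim: mu la => [|m mu IH] la pla pmu szE.
  by move/size0nil: szE => -> /=; rewrite /step_word /kl_op /= asboolT.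
rewrite szE /=; move nE : (size mu).+1 => n.
have {}szE : size la = n by rewrite szE -nE.
have stepE k : k != n -> E k (step_word C n) = 0 by apply: tlgen_step.
have [|npk] := EM (is_peak n la (n + m)%N); last first.
  have -> : cup t (n + m) (kl n la (step_word C n)) = 0.
    apply: cup_killed.
    apply: (kl_op_nonpeak (heckeE (n + m + head 0 la).+1%N) baxterg) => //.
    - by rewrite szE.
    - by lia.
    - by move=> l _; apply: stepE.
    - by rewrite szE; lia.
  rewrite link_eval0.
  by case: eqP npk => // -> []; exists [::], m, mu; rewrite subn0.
case=> l1 [m1 [l2 [laE ml1 cE]]].
have szla : n = (size l1 + (size l2).+1)%N by rewrite -szE laE size_cat.
rewrite cE (kl_cup_peak laE) ?szE //; last first.
  by move=> k _; apply: stepE.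
have szla' : size (map predn l1 ++ l2) = size mu by rewrite size_cat size_map; lia.
rewrite -nE cup_stepS // succnK -{1 2}szla'.
rewrite IH //; last first.
- by case/andP: pmu.
- by apply: (@pairwise_geq_delete _ m1); rewrite -?laE.
congr (nat_of_bool _)%:R; rewrite laE.
case: l1 laE ml1 cE szla szla' => [|a l1] laE ml1 cE szla szla' /=.
  by rewrite eqseq_cons (_ : m1 = m) ?eqxx //; move: cE; rewrite /=; lia.
(* a peak below the first row of la leaves a first row longer than m *)
have am : (m1 < a)%N by case/andP: ml1.
rewrite eqseq_cons (_ : (a == m) = false) /=; last by move: cE; rewrite /=; lia.
apply/eqP => h; move: pmu; rewrite -h /= => /andP[/andP[]].
by move: cE; rewrite /=; lia.
Qed.

(** * The Macdonald product on link patterns *)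

(** Functionals that vanish on all link patterns with n arcs, generated by all
    sequences of cups and not only by those of [link_eval], which makes stability
    under the generators provable. *)
Fixpoint null_on (n : nat) phi : Prop :=
  if n is n'.+1 then forall c, (0 < c < n.*2)%N -> null_on n' (cup t c phi)
  else phi (fun i => i <= 0)%N = 0.

Lemma null_on_linear n a x y : null_on n x -> null_on n y -> null_on n (a *: x + y).
Proof.
elim: n x y => [|n IH] x y /= Hx Hy.
  by rewrite -[LHS]/(a * x _ + y _) Hx Hy mulr0 addr0.
by move=> c hc; rewrite cup_linear; apply: IH; [apply: Hx|apply: Hy].
Qed.

Lemma null_on0 n : null_on n 0.
Proof. by elim: n => //= n IH c _; rewrite cup0. Qed.

Lemma null_onZ n a x : null_on n x -> null_on n (a *: x).
Proof.
by move=> Hx; rewrite -[a *: x]addr0; apply: null_on_linear => //; apply: null_on0.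
Qed.

Lemma null_onD n x y : null_on n x -> null_on n y -> null_on n (x + y).
Proof. by move=> Hx Hy; rewrite -[x]scale1r; apply: null_on_linear. Qed.

Lemma null_on_eval mu phi : null_on (size mu) phi ->
  (forall i, (i < size mu)%N -> (nth 0 mu i < size mu - i)%N) -> link_eval mu phi = 0.
Proof.
elim: mu phi => //= m mu IH phi H Hmu; apply: IH.
  by apply: H; have := Hmu 0%N (ltn0Sn _); rewrite /=; lia.
by move=> i hi; have := Hmu i.+1 hi; rewrite subSS.
Qed.

Lemma null_on_tlgen n i phi : (0 < i < n.*2)%N -> null_on n phi -> null_on n (E i phi).
Proof.
elim: n i phi => [|n IH] i phi /=; first by lia.
move=> hi H c hc; case: (ltngtP c i) => [ci|ic|->].
- case: (eqVneq i c.+1) => [->|ne].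
    by rewrite cup_tlgen_right //; apply: H; lia.
  by rewrite cup_tlgen_above //; [apply: IH; [lia|exact: H]|lia].
- case: (eqVneq c i.+1) => [->|ne].
    by rewrite cup_tlgen_left //; apply: H; lia.
  by rewrite cup_tlgen_below //; [apply: IH; [lia|exact: H]|lia].
- by rewrite cup_tlgen //; apply: null_onZ; apply: H.
Qed.

Lemma null_on_box_op n i u phi : (0 < i < n.*2)%N ->
  null_on n phi -> null_on n (T i u phi).
Proof.
by move=> hi H; rewrite /box_op addrC; apply: null_on_linear => //; apply: null_on_tlgen.
Qed.

Lemma null_on_diag N n la u phi :
  (forall i j, (j < nth 0 la i)%N -> (0 < n - i + j < N.*2)%N) ->
  null_on N phi -> null_on N (diag n la u phi).
Proof.
move=> H; apply: (diag_op_closed (P := null_on N)) => i j y ij.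
by apply: null_on_box_op; apply: H.
Qed.

(** Among n + 1 consecutive of the 2 n strands, two are joined by an arc, hence two
    adjacent ones are. *)
Lemma consecutive_null n s phi : (s + n < n.*2)%N ->
  (forall k, (s < k <= s + n)%N -> E k phi = 0) -> null_on n phi.
Proof.
elim: n s phi => [|n IH] s phi sn H /=; first by lia.
move=> c hc; case: (ltnP s c) => sc; last first.
  (* a cup at the left edge of the window takes one of its strands away *)
  pose s' := (if s == c then s.-1 else s - 2)%N.
  have [hs1 hs2] : (s' + n < n.*2)%N /\ (c.-1 <= s' /\ s - 2 <= s' <= s.-1)%N.
    by rewrite /s'; case: eqVneq => h /=; do ?split; lia.
  apply: (IH s') => // k hk; have -> : k = (k.+2 - 2)%N by lia.
  have h3 : (c.+1 < k.+2)%N by lia.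
  by rewrite -cup_tlgen_above // H ?cup0 //; lia.
case: (leqP c (s + n.+1)) => cs.
  by rewrite cup_killed ?H ?sc //; apply: null_on0.
apply: (IH s); first by lia.
by move=> k hk; rewrite -cup_tlgen_below ?H ?cup0 //; lia.
Qed.

Fixpoint stair (n : nat) : seq nat := if n is n'.+1 then n' :: stair n' else [::].

Lemma size_stair n : size (stair n) = n.
Proof. by elim: n => //= n ->. Qed.

Lemma nth_stair n i : nth 0%N (stair n) i = (n - i.+1)%N.
Proof. by elim: n i => [|n IH] [|i] //=; rewrite ?subSS ?subn0 ?IH. Qed.

Definition macdonald n phi := diag n (stair n) (fun i j => n - i - j)%N phi.

Lemma macdonald_cup_top n :
  cup t n.*2.+1 (macdonald n.+1 (step_word C n.+1)) = macdonald n (step_word C n).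
Proof.
rewrite {1}/macdonald /= cup_diag_below //; last first.
  by move=> i j; rewrite nth_stair; lia.
rewrite (_ : n.*2.+1 = n.+1 + n)%N; last by lia.
rewrite cup_row // ?cup_stepS //; last by move=> k hk; apply: tlgen_step => //; lia.
Qed.

(** The added box, filled with 1, is the corner of a rectangle of n - b rows and b + 1
    columns that carries its Kazhdan-Lusztig filling.  All the E_k with b < k <= b + n
    kill the product over this rectangle, and the remaining boxes preserve [null_on]. *)
Lemma macdonald_null n b : (b < n)%N ->
  null_on n (T b.*2.+1 1 (macdonald n (step_word C n))).
Proof.
move=> bn; pose l1 := take (n - b.+1) (stair n); pose l2 := drop (n - b) (stair n).
have sz1 : size l1 = (n - b.+1)%N by rewrite size_takel // size_stair; lia.
have stE : stair n = l1 ++ b :: l2.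
  rewrite -{1}(cat_take_drop (n - b.+1) (stair n)) (drop_nth 0%N) ?size_stair;
    last by lia.
  by rewrite nth_stair subnSK // subKn // ltnW.
have pst : pairwise geq (stair n).
  by apply/pairwise_geqP => i j ij; rewrite !nth_stair; lia.
have nth1 i : (i < size l1)%N -> nth 0%N l1 i = (n - i.+1)%N.
  by move=> hi; have := nth_stair n i; rewrite stE nth_cat hi.
have nth2 i : nth 0%N l2 i = (b - i.+1)%N.
  by rewrite nth_drop nth_stair; lia.
pose u i j := (n - i - j)%N.
(* b.*2.+1 is the index of the box to the right of the row of length b *)
have -> : T b.*2.+1 1 (macdonald n (step_word C n)) =
    diag n (rcons l1 b.+1 ++ l2) u (step_word C n).
  rewrite cat_rcons (diag_op_add_box _ (heckeE n.*2)) -?stE ?size_stair //; last by lia.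
  congr (box_op _ _ _ _ _); last by rewrite /u; lia.
  by lia.
have szr : size (rcons l1 b.+1) = (n - b)%N by rewrite size_rcons sz1; lia.
rewrite diag_op_cat szr; apply: null_on_diag.
  by move=> i j; rewrite nth2; lia.
rewrite (@diag_split_columns _ t g n _ b.+1); last by lia.
  apply: null_on_diag.
    move=> i j; case: (ltnP i (size (rcons l1 b.+1))) => hi; last first.
      by rewrite nth_default ?size_map.
    rewrite (nth_map 0%N) // nth_rcons; case: (ltnP i (size l1)) => hi1.
      by rewrite nth1 //; lia.
    by case: eqP => _ hj; lia.
  have -> : diag n (nseq (size (rcons l1 b.+1)) b.+1) u (step_word C n) =
            kl n (nseq (n - b) b.+1) (step_word C n).
    rewrite szr; apply: eq_diag_op => i j; rewrite nth_nseq; case: ifP => // ir hj.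
    by rewrite klfill_nseq // /u; lia.
  apply: (@consecutive_null n b); first by lia.
  move=> k hk; apply: (@kl_rect_kill _ _ _ _ (n + b)) => //; try lia.
  by move=> l _ ln; apply: tlgen_step.
apply/allP => x; rewrite mem_rcons inE => /orP[/eqP->//|/(nthP 0%N)[i hi <-]].
rewrite nth1 //=; by move: hi; rewrite sz1; lia.
Qed.

Lemma exchange_subr (V : lmodType C) (a b e y : V) :
  a - y = (a - e) + ((-1) *: (b - e) + (b - y)).
Proof. by rewrite scaleN1r opprB -!addrA; congr (_ + _); rewrite !addKr. Qed.

Lemma exchange_scaler (V : lmodType C) (s : C) (a b y : V) : s != 0 ->
  a - s^-1 *: y = (- s^-1) *: (b - s *: a) + s^-1 *: (b - y).
Proof.
move=> s0; rewrite !scalerBr scalerA mulNr mulVf // !scaleNr scale1r opprK.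
by rewrite [- _ + a]addrC -addrA addKr.
Qed.

(** The weight of an arc whose left end is at position c. *)
Definition arc_weight (c : nat) : C := if odd c then 1 else tau^-1.

(** Closing by a cup at e the relation (E_c - tau) M = 0, where c is odd and e is next
    to c. *)
Lemma macdonald_cup_neighbour n b e : (b <= n)%N -> (0 < e < n.+1.*2)%N ->
  (e == b.*2)%N || (e == b.*2.+2)%N ->
  null_on n (cup t b.*2.+1 (macdonald n.+1 (step_word C n.+1))
             - tau *: cup t e (macdonald n.+1 (step_word C n.+1))).
Proof.
move=> bn he eb; have := macdonald_null (bn : (b < n.+1)%N).
move: (macdonald _ _) => x /(_ e he).
rewrite /box_op addrC cup_linear addrC (baxter1 baxterg) scaleNr.
by case/orP: eb => /eqP ->; rewrite ?cup_tlgen_left ?cup_tlgen_right.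
Qed.

Lemma macdonald_cup n c : (0 < c < n.+1.*2)%N ->
  null_on n (cup t c (macdonald n.+1 (step_word C n.+1))
             - arc_weight c *: macdonald n (step_word C n)).
Proof.
have := @macdonald_cup_neighbour n; have := macdonald_cup_top n.
move: (macdonald n.+1 _) (macdonald n _) => x y top nb hc.
(* odd positions are treated from the last one down, two steps at a time *)
have odd_case d : (d <= n)%N -> null_on n (cup t (n - d).*2.+1 x - y).
  elim: d => [|d IH] dn; first by rewrite subn0 top subrr; apply: null_on0.
  have := nb (n - d)%N (n - d).*2.
  have := nb (n - d.+1)%N (n - d).*2.
  move=> H1 H2; have -> : cup t (n - d.+1).*2.+1 x - y =
     (cup t (n - d.+1).*2.+1 x - tau *: cup t (n - d).*2 x) +
     ((-1) *: (cup t (n - d).*2.+1 x - tau *: cup t (n - d).*2 x) +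
      (cup t (n - d).*2.+1 x - y)).
    exact: exchange_subr.
  apply: null_onD; first by apply: H1; lia.
  apply: null_on_linear; last by apply: IH; lia.
  by apply: H2; lia.
rewrite /arc_weight; case: ifP => oc.
  have -> : c = (n - (n - c./2)).*2.+1 by lia.
  by rewrite scale1r; apply: odd_case; lia.
have cE : c = c./2.*2 by lia.
have -> : cup t c x - tau^-1 *: y =
    (- tau^-1) *: (cup t c.-1 x - tau *: cup t c x) + tau^-1 *: (cup t c.-1 x - y).
  exact: exchange_scaler.
have -> : c.-1 = (c./2.-1).*2.+1 by lia.
apply: null_on_linear; first by apply: nb => //; lia.
have -> : c./2.-1 = (n - (n - c./2.-1))%N by lia.
by apply: null_onZ; apply: odd_case; lia.
Qed.

Fixpoint link_weight (mu : seq nat) : C :=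
  if mu is m :: mu' then arc_weight (size mu + m) * link_weight mu' else 1.

Lemma link_eval_macdonald mu :
  (forall i, (i < size mu)%N -> (nth 0 mu i < size mu - i)%N) ->
  link_eval mu (macdonald (size mu) (step_word C (size mu))) = link_weight mu.
Proof.
elim: mu => [|m mu IH] H; first by rewrite /= /step_word /macdonald /= asboolT.
have Hmu i : (i < size mu)%N -> (nth 0 mu i < size mu - i)%N.
  by move=> hi; have := H i.+1 hi; rewrite subSS.
have hm := H 0%N (ltn0Sn _).
have hc : (0 < (size mu).+1 + m < (size mu).+1.*2)%N by move: hm; rewrite /=; lia.
rewrite [LHS]/= [RHS]/= -IH //.
have := null_on_eval (macdonald_cup hc) Hmu.
rewrite -scaleN1r addrC link_eval_linear mulN1r addrC => /eqP.
rewrite subr_eq0 => /eqP ->.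
by rewrite -[arc_weight _ *: _]addr0 link_eval_linear link_eval0 addr0.
Qed.

End LinkPatterns.

(** * The polynomial module *)

(** E = n - c turns the relations of the operators n, with n ^ 2 = c n, into those of a
    Hecke module. *)
Lemma hecke_shift (C : fieldType) (V : lmodType C) (c : C) (N : nat) (n : nat -> V -> V) :
  (forall k, (0 < k < N)%N -> linear (n k)) ->
  (forall k x, (0 < k < N)%N -> n k (n k x) = c *: n k x) ->
  (forall k l x, (0 < k)%N -> (k.+1 < l)%N -> (l < N)%N -> n k (n l x) = n l (n k x)) ->
  (forall k x, (0 < k)%N -> (k.+1 < N)%N ->
     n k (n k.+1 (n k x)) - n k x = n k.+1 (n k (n k.+1 x)) - n k.+1 x) ->
  hecke_module (- c) N (fun k x => if (0 < k < N)%N then n k x - c *: x else 0).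
Proof.
move=> lin quad comm braid.
have nB k x y : (0 < k < N)%N -> n k (x - c *: y) = n k x - c *: n k y.
  by move=> kN; rewrite addrC -scaleNr lin // addrC scaleNr.
split.
- move=> k a x y; case: ifP => kN; last by rewrite scaler0 addr0.
  by rewrite lin // scalerBr scalerDr opprD addrACA !scalerA [c * a]mulrC.
- by move=> k x kN; rewrite kN nB // quad // subrr sub0r scaleNr.
- move=> k l x k0 kl lN.
  have kN : (0 < k < N)%N by lia.
  have lN' : (0 < l < N)%N by lia.
  rewrite kN lN' !nB // comm // !scalerBr !opprB !addrA.
  by rewrite [LHS](ACl (1*4*3*2)).
- move=> k x k0 kN1; have kN : (0 < k < N)%N by lia.
  have lN : (0 < k.+1 < N)%N by lia.
  rewrite kN lN !nB // !quad // !subrr !scalerBr !scaler0 !subr0 !opprB !addrA.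
  rewrite [LHS](ACl (1*8*6*5*4*3*2*7)) [RHS](ACl (1*8*2*3*4*5*6*7)) /=.
  by rewrite braid.
Qed.

Section FieldIdentities.
Variables (F : fieldType) (t : F).

(** The value of nabla_k f when z_k, z_(k+1), f and s_k f take the values x, y, a, b. *)
Definition hecke_quot (x y a b : F) : F := (t * x - t^-1 * y) / (x - y) * (a - b).

Hypothesis t0 : t != 0.

Lemma hecke_quot_quad x y a b : x != y ->
  hecke_quot x y (hecke_quot x y a b) (hecke_quot y x b a) =
  (t + t^-1) * hecke_quot x y a b.
Proof.
move=> xy; rewrite /hecke_quot.
have h1 : x - y != 0 by rewrite subr_eq0.
have h2 : y - x != 0 by rewrite -opprB oppr_eq0.
by field; rewrite t0 h1 h2.
Qed.

Lemma hecke_quot_braid x y z f0 f1 f2 f12 f21 f121 : x != y -> x != z -> y != z ->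
  let n := hecke_quot in
  n x y (n y z (n x y f0 f1) (n x z f2 f21))
        (n x z (n y x f1 f0) (n y z f12 f121)) - n x y f0 f1 =
  n y z (n x y (n y z f0 f2) (n x z f1 f12))
        (n x z (n z y f2 f0) (n x y f21 f121)) - n y z f0 f2.
Proof.
move=> xy xz yz; rewrite /hecke_quot /=.
have h1 : x - y != 0 by rewrite subr_eq0.
have h2 : y - x != 0 by rewrite -opprB oppr_eq0.
have h3 : x - z != 0 by rewrite subr_eq0.
have h4 : y - z != 0 by rewrite subr_eq0.
have h5 : z - y != 0 by rewrite -opprB oppr_eq0.
by field; rewrite t0 h1 h2 h3 h4 h5.
Qed.

(** Here and in [hecke_image_braid] the operators are abstract and enter through their
    images in the field, so that conversion never unfolds operators on polynomials. *)
Lemma hecke_image_comm (P : Type) (frac_of : P -> F) (nk nl sk sl : P -> P) xa xb xc xd :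
  let q := hecke_quot in
  (forall f, frac_of (nk f) = q xa xb (frac_of f) (frac_of (sk f))) ->
  (forall f, frac_of (nl f) = q xc xd (frac_of f) (frac_of (sl f))) ->
  (forall f, frac_of (sk (nl f)) = q xc xd (frac_of (sk f)) (frac_of (sk (sl f)))) ->
  (forall f, frac_of (sl (nk f)) = q xa xb (frac_of (sl f)) (frac_of (sl (sk f)))) ->
  (forall f, sl (sk f) = sk (sl f)) ->
  forall f, frac_of (nk (nl f)) = frac_of (nl (nk f)).
Proof.
by move=> q hk hl hkl hlk hs f; rewrite hk hl hkl hl hlk hk hs /q /hecke_quot; ring.
Qed.

Lemma hecke_image_braid (P : Type) (frac_of : P -> F) (n1 n2 s1 s2 : P -> P) x y z :
  x != y -> x != z -> y != z ->
  let q := hecke_quot in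
  (forall f, frac_of (n1 f) = q x y (frac_of f) (frac_of (s1 f))) ->
  (forall f, frac_of (n2 f) = q y z (frac_of f) (frac_of (s2 f))) ->
  (forall f, frac_of (s1 (n1 f)) = q y x (frac_of (s1 f)) (frac_of (s1 (s1 f)))) ->
  (forall f, frac_of (s2 (n2 f)) = q z y (frac_of (s2 f)) (frac_of (s2 (s2 f)))) ->
  (forall f, frac_of (s2 (n1 f)) = q x z (frac_of (s2 f)) (frac_of (s2 (s1 f)))) ->
  (forall f, frac_of (s1 (n2 f)) = q x z (frac_of (s1 f)) (frac_of (s1 (s2 f)))) ->
  (forall f, frac_of (s1 (s2 (n1 f))) = 
     q y z (frac_of (s1 (s2 f))) (frac_of (s1 (s2 (s1 f))))) ->
  (forall f, frac_of (s2 (s1 (n2 f))) = 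
     q x y (frac_of (s2 (s1 f))) (frac_of (s2 (s1 (s2 f))))) ->
  (forall f, s1 (s1 f) = f) -> (forall f, s2 (s2 f) = f) ->
  (forall f, s2 (s1 (s2 f)) = s1 (s2 (s1 f))) ->
  forall f, frac_of (n1 (n2 (n1 f))) - frac_of (n1 f) =
    frac_of (n2 (n1 (n2 f))) - frac_of (n2 f).
Proof.
move=> xy xz yz q h1 h2 h11 h22 h21 h12 h121 h212 s1K s2K sB f.
rewrite h1 h2 h12 h1 h21 h11 h121 h2 h1 h21 h22 h212 h2 h12 s1K s2K sB.
exact: hecke_quot_braid.
Qed.

End FieldIdentities.

Section Polynomials.
Variables (C : fieldType) (t : C) (N : nat).
Notation P := {mpoly C[N]}.
Implicit Types f : P.

Lemma msym_var (s : 'S_N) (i : 'I_N) : msym s ('X_i : P) = 'X_(s i).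
Proof. by rewrite /msym mmapX mmap1U. Qed.

Definition consecutive (k : nat) (a b : 'I_N) : Prop :=
  [/\ zvar C N k = 'X_a, zvar C N k.+1 = 'X_b, zperm N k = tperm a b,
      a = k.-1 :> nat & b = k :> nat].

Lemma consecutive_vars k : (0 < k < N)%N -> exists a b, consecutive k a b.
Proof.
case/andP=> k0 kN.
have k1N : (k.-1 < N)%N by lia.
exists (Ordinal k1N), (Ordinal kN); rewrite /consecutive /zvar /zperm /=.
by rewrite (insubT (fun x => x < N)%N k1N) (insubT (fun x => x < N)%N kN).
Qed.

Lemma consecutive_neq k a b : (0 < k)%N -> consecutive k a b -> a != b.
Proof. by move=> k0 [_ _ _ ak bk]; apply/eqP => ab; move: ak bk; rewrite ab; lia. Qed.

Lemma zswapK k f : zswap k (zswap k f) = f.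
Proof.
rewrite /zswap -msymMm (_ : (zperm N k * zperm N k)%g = 1%g) ?msym1m //.
rewrite /zperm; case: (insub k.-1 : option 'I_N) => [a|]; case: (insub k : option 'I_N) => [b|];
  rewrite ?mulg1 //.
exact: tperm2.
Qed.

Lemma divided_difference_linear k : (0 < k < N)%N ->
  linear (@divided_difference C N k).
Proof.
move=> kN c f h; apply/esym/divided_difference_unique => //.
have distr (u v w : P) : u * (c *: v + w) = c *: (u * v) + u * w.
  by rewrite mulrDr -scalerAr.
apply: etrans (distr _ _ _) _.
apply: etrans (congr2 (fun u v => c *: u + v) (divided_differenceP k f)
                 (divided_differenceP k h)) _.
rewrite /zswap msymD msymZ; move: (msym _ f) (msym _ h) => f' h'.
by rewrite scalerBr opprD addrACA.
Qed.

Lemma nabla_linear k : (0 < k < N)%N -> linear (@nabla C N t k).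
Proof.
by move=> kN c f h; rewrite /nabla divided_difference_linear // mulrDr -scalerAr.
Qed.

(** Set to 0 out of range, where nabla need not be linear. *)
Definition poly_gen (k : nat) f : P :=
  if (0 < k < N)%N then nabla t k f - (t + t^-1) *: f else 0.

Lemma poly_genE k f : (0 < k < N)%N -> poly_gen k f = nabla t k f - (t + t^-1) *: f.
Proof. by rewrite /poly_gen => ->. Qed.

Lemma nabla_eigen k a b (f G : P) : consecutive k a b -> (0 < k < N)%N ->
  f = (t *: 'X_a - t^-1 *: 'X_b) * G -> zswap k G = G -> poly_gen k f = 0.
Proof.
move=> kab kN fE sG; rewrite poly_genE //; have [za zb zk _ _] := kab.
rewrite /nabla -(@divided_difference_unique _ _ k f ((t + t^-1) *: G)) //.
  by rewrite za zb -scalerAr -fE subrr.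
rewrite za zb fE /zswap msymM -/(zswap k G) sG msymB !msymZ !msym_var zk tpermL tpermR.
rewrite -mulrBl -scalerAr scalerAl; congr (_ * _).
by rewrite scalerBr !scalerDl opprD opprB [in RHS]addrACA [- _ - _ in RHS]addrC.
Qed.

(** The exchange of two consecutive arguments permutes the factors of Delta other
    than the one that contains both. *)
Lemma Delta_swap k M (x : 'I_M -> P) (a0 b0 : 'I_M) :
  (b0 = a0.+1 :> nat) -> (forall i, zswap k (x i) = x (tperm a0 b0 i)) ->
  exists2 G, Delta t x = (t *: x a0 - t^-1 *: x b0) * G & zswap k G = G.
Proof.
move=> ab sx; rewrite /Delta pair_big_dep /=.
rewrite (bigD1 (a0, b0)) /=; last by rewrite ab.
eexists; first by reflexivity.
rewrite /zswap rmorph_prod /=.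
pose h := fun p : 'I_M * 'I_M => (tperm a0 b0 p.1, tperm a0 b0 p.2).
have hK : involutive h by move=> [i j]; rewrite /h /= !tpermK.
rewrite [RHS](reindex_inj (inv_inj hK)) /=; apply: eq_big => [[i j]|[i j] _] /=.
  have ne (u v : 'I_M) : u <> v -> (u : nat) <> v by move=> uv /val_inj.
  rewrite !xpair_eqE -!val_eqE /=.
  by case: tpermP => [->|->|/ne ia /ne ib]; case: tpermP => [->|->|/ne ja /ne jb]; lia.
by rewrite msymB !msymZ -!/(zswap _ _) !sx.
Qed.

Lemma Delta_fixed k M (x : 'I_M -> P) :
  (forall i, zswap k (x i) = x i) -> zswap k (Delta t x) = Delta t x.
Proof.
move=> sx; rewrite /Delta /zswap rmorph_prod; apply: eq_bigr => i _ /=.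
rewrite rmorph_prod; apply: eq_bigr => j _ /=.
by rewrite msymB !msymZ -!/(zswap _ _) !sx.
Qed.

Hypothesis t_neq0 : t != 0.

Definition frac_of (f : P) : {fraction P} := tofrac f.

Definition frac_t : {fraction P} := frac_of t%:MP.

Lemma frac_t_neq0 : frac_t != 0.
Proof. by rewrite /frac_t /frac_of tofrac_eq0 mpolyC_eq0. Qed.

Lemma frac_of_inj : injective frac_of.
Proof. by move=> f h; rewrite /frac_of => /eqP; rewrite tofrac_eq => /eqP. Qed.

Lemma frac_tV : frac_of (t^-1)%:MP = frac_t^-1.
Proof.
apply: (mulfI frac_t_neq0); rewrite mulfV ?frac_t_neq0 //.
rewrite /frac_t /frac_of -rmorphM /= -mpolyCM.
by rewrite mulfV // rmorph1.
Qed.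

Lemma frac_of_scale f : frac_of ((t + t^-1) *: f) = (frac_t + frac_t^-1) * frac_of f.
Proof.
rewrite -mul_mpolyC /frac_of rmorphM /= mpolyCD rmorphD /=.
by rewrite -[X in (_ + X) * _]/(frac_of _) frac_tV.
Qed.

Lemma frac_ofB f h : frac_of (f - h) = frac_of f - frac_of h.
Proof. exact: rmorphB. Qed.

Lemma frac_of_var_neq (i j : 'I_N) : i != j -> frac_of 'X_i != frac_of 'X_j.
Proof.
move=> ij; apply/eqP => /frac_of_inj /(congr1 (mcoeff U_(i)%MM)).
rewrite !mcoeffX eqxx => /eqP; rewrite (_ : (U_(j) == U_(i))%MM = false) ?oner_eq0 //.
apply/eqP => /(congr1 (fun m : 'X_{1..N} => m i)); rewrite !mnm1E eqxx eq_sym.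
by rewrite (negbTE ij).
Qed.

Lemma frac_of_nabla (s : 'S_N) k a b f : consecutive k a b -> a != b ->
  frac_of (msym s (nabla t k f)) =
  hecke_quot frac_t (frac_of 'X_(s a)) (frac_of 'X_(s b))
    (frac_of (msym s f)) (frac_of (msym s (zswap k f))).
Proof.
move=> [za zb _ _ _] ab; rewrite /nabla za zb msymM.
have := congr1 (fun p => frac_of (msym s p)) (divided_differenceP k f).
rewrite za zb msymM !msymB !msym_var !msymZ !msym_var /frac_of !rmorphM !rmorphB /= => h.
have ne : (tofrac ('X_(s a) : P)) - tofrac 'X_(s b) != 0.
  by rewrite subr_eq0 frac_of_var_neq // (inj_eq perm_inj).
rewrite /hecke_quot -/(frac_of _) -h mulrA mulfVK //.
by rewrite -frac_tV -!mul_mpolyC /frac_t /frac_of !rmorphM.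
Qed.

Lemma frac_of_nabla1 k a b f : consecutive k a b -> a != b ->
  frac_of (nabla t k f) =
  hecke_quot frac_t (frac_of 'X_a) (frac_of 'X_b) (frac_of f) (frac_of (zswap k f)).
Proof. by move=> kab ab; have := frac_of_nabla 1%g f kab ab; rewrite !msym1m !perm1. Qed.

Lemma frac_of_zswap_nabla j k a b f : consecutive k a b -> a != b ->
  frac_of (zswap j (nabla t k f)) =
  hecke_quot frac_t (frac_of 'X_(zperm N j a)) (frac_of 'X_(zperm N j b))
    (frac_of (zswap j f)) (frac_of (zswap j (zswap k f))).
Proof. exact: frac_of_nabla. Qed.

Lemma frac_of_zswap2_nabla i j k a b f : consecutive k a b -> a != b ->
  frac_of (zswap i (zswap j (nabla t k f))) =
  hecke_quot frac_t (frac_of 'X_(zperm N i (zperm N j a))) (frac_of 'X_(zperm N i (zperm N j b)))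
    (frac_of (zswap i (zswap j f))) (frac_of (zswap i (zswap j (zswap k f)))).
Proof.
move=> kab ab; rewrite [zswap i (zswap j (nabla _ _ _))]/zswap -msymMm.
by rewrite (frac_of_nabla _ _ kab ab) !msymMm !permM.
Qed.

Lemma nabla_quad k f : (0 < k < N)%N ->
  nabla t k (nabla t k f) = (t + t^-1) *: nabla t k f.
Proof.
move=> kN; have [a [b kab]] := consecutive_vars kN.
have ab : a != b by apply: consecutive_neq kab; lia.
apply: frac_of_inj; rewrite (frac_of_nabla1 _ kab) // (frac_of_nabla1 _ kab) //.
have zE : zperm N k = tperm a b by case: kab.
rewrite (frac_of_zswap_nabla _ _ kab) // zswapK zE tpermL tpermR.
rewrite (hecke_quot_quad frac_t_neq0 _ _ (frac_of_var_neq ab)).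
by rewrite -(frac_of_nabla1 _ kab) // -frac_of_scale.
Qed.

Lemma nabla_comm k l f : (0 < k)%N -> (k.+1 < l)%N -> (l < N)%N ->
  nabla t k (nabla t l f) = nabla t l (nabla t k f).
Proof.
move=> k0 kl lN.
have kN : (0 < k < N)%N by lia.
have lN' : (0 < l < N)%N by lia.
have [a [b kab]] := consecutive_vars kN; have [c [d lcd]] := consecutive_vars lN'.
have ab := consecutive_neq k0 kab.
have cd : c != d by apply: consecutive_neq lcd; lia.
have [_ _ zk ak bk] := kab; have [_ _ zl cl dl] := lcd.
have ne : [/\ a != c, a != d, b != c & b != d].
  by split; apply/eqP => /(congr1 val) /= h; lia.
case: ne => ac ad bc bd.
have tc : tperm a b c = c /\ tperm a b d = d by rewrite !tpermD.
have ta : tperm c d a = a /\ tperm c d b = b by rewrite !tpermD // eq_sym.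
apply: frac_of_inj; apply: (@hecke_image_comm _ frac_t _ frac_of (nabla t k) (nabla t l)
  (zswap k) (zswap l)
  (frac_of 'X_a) (frac_of 'X_b) (frac_of 'X_c) (frac_of 'X_d)) => h.
- exact: frac_of_nabla1 kab ab.
- exact: frac_of_nabla1 lcd cd.
- by rewrite (frac_of_zswap_nabla k h lcd cd) zk tc.1 tc.2.
- by rewrite (frac_of_zswap_nabla l h kab ab) zl ta.1 ta.2.
- rewrite /zswap -!msymMm zk zl; congr (msym _ _).
  by rewrite conjgC tpermJ ta.1 ta.2.
Qed.

Lemma nabla_braid k f : (0 < k)%N -> (k.+1 < N)%N ->
  nabla t k (nabla t k.+1 (nabla t k f)) - nabla t k f =
  nabla t k.+1 (nabla t k (nabla t k.+1 f)) - nabla t k.+1 f.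
Proof.
move=> k0 kN1; have kN : (0 < k < N)%N by lia.
have lN : (0 < k.+1 < N)%N by lia.
have [a [b kab]] := consecutive_vars kN; have [b' [c lbc]] := consecutive_vars lN.
have b'E : b' = b by apply/val_inj => /=; case: kab => _ _ _ _ ->; case: lbc.
subst b'; have ab := consecutive_neq k0 kab; have bc := consecutive_neq (ltn0Sn k) lbc.
have [_ _ zk ak bk] := kab; have [_ _ zl bl cl] := lbc.
have ac : a != c by apply/eqP => /(congr1 val) /= h; lia.
have tc : tperm a b c = c by rewrite tpermD // eq_sym.
have ta : tperm b c a = a by rewrite tpermD // eq_sym.
apply: frac_of_inj; apply: etrans (frac_ofB _ _) _; apply: etrans (esym (frac_ofB _ _)).
apply: (@hecke_image_braid _ frac_t frac_t_neq0 _ frac_of (nabla t k) (nabla t k.+1)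
  (zswap k) (zswap k.+1)
  (frac_of 'X_a) (frac_of 'X_b) (frac_of 'X_c)) => [||| h|h|h|h|h|h|h|h|h|h|h].
- exact: frac_of_var_neq.
- exact: frac_of_var_neq.
- exact: frac_of_var_neq.
- exact: frac_of_nabla1 kab ab.
- exact: frac_of_nabla1 lbc bc.
- by rewrite (frac_of_zswap_nabla k h kab ab) zk tpermL tpermR.
- by rewrite (frac_of_zswap_nabla k.+1 h lbc bc) zl tpermL tpermR.
- by rewrite (frac_of_zswap_nabla k.+1 h kab ab) zl tpermL ta.
- by rewrite (frac_of_zswap_nabla k h lbc bc) zk tpermR tc.
- by rewrite (frac_of_zswap2_nabla k k.+1 h kab ab) zk zl ta !tpermL tc.
- by rewrite (frac_of_zswap2_nabla k.+1 k h lbc bc) zk zl tc !tpermR ta.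
- exact: zswapK.
- exact: zswapK.
- rewrite /zswap -!msymMm zk zl; congr (msym _ _).
  have j1 : (tperm a b ^ tperm b c = tperm a c)%g by rewrite tpermJ ta tpermL.
  have j2 : (tperm b c ^ tperm a b = tperm a c)%g by rewrite tpermJ tpermR tc.
  by move: j1 j2; rewrite /conjg !tpermV !mulgA => -> ->.
Qed.

Lemma poly_gen_hecke : hecke_module (- (t + t^-1)) N poly_gen.
Proof.
apply: (@hecke_shift _ _ (t + t^-1) N (nabla t)).
- exact: nabla_linear.
- by move=> k f kN; apply: nabla_quad.
- by move=> k l f k0 kl lN; apply: nabla_comm.
- by move=> k f k0 kN; apply: nabla_braid.
Qed.

End Polynomials.

Lemma DeltaDelta_kill (C : fieldType) (t : C) n k : (0 < k < n + n)%N -> k != n ->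
  poly_gen t k (DeltaDelta t n) = 0.
Proof.
move=> kN kn; have [a [b kab]] := consecutive_vars C kN.
have [_ _ zk ak bk] := kab.
pose xl := fun i : 'I_n => 'X_(lshift n i) : {mpoly C[n + n]}.
pose xr := fun i : 'I_n => 'X_(rshift n i) : {mpoly C[n + n]}.
have zv i : zswap k ('X_i : {mpoly C[n + n]}) = 'X_(tperm a b i).
  by rewrite /zswap msym_var zk.
have kill f G (a' b' : 'I_(n + n)) : a' = a -> b' = b ->
    f = (t *: 'X_a' - t^-1 *: 'X_b') * G -> zswap k G = G -> poly_gen t k f = 0.
  by move=> -> -> fE sG; apply: nabla_eigen fE sG.
case: (ltnP k n) => h.
  have k1n : (k.-1 < n)%N by lia.
  pose a0 := Ordinal k1n; pose b0 := Ordinal h.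
  have aE : lshift n a0 = a by apply/val_inj; rewrite /= ak.
  have bE : lshift n b0 = b by apply/val_inj; rewrite /= bk.
  have [||G GE sG] := @Delta_swap C t (n + n) k n xl a0 b0.
  - by rewrite /=; lia.
  - by move=> i; rewrite /xl zv -aE -bE inj_tperm //; apply: lshift_inj.
  apply: (kill _ (G * Delta t xr) _ _ aE bE); first by rewrite /DeltaDelta GE mulrA.
  rewrite /zswap msymM -!/(zswap _ _) sG Delta_fixed // => i.
  by rewrite /xr zv -aE -bE tpermD // eq_lrshift.
have k1n : (k.-1 - n < n)%N by lia.
have k2n : (k - n < n)%N by lia.
pose a0 := Ordinal k1n; pose b0 := Ordinal k2n.
have aE : rshift n a0 = a by apply/val_inj; rewrite /= ak; lia.
have bE : rshift n b0 = b by apply/val_inj; rewrite /= bk; lia.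
have [||G GE sG] := @Delta_swap C t (n + n) k n xr a0 b0.
- by rewrite /=; lia.
- by move=> i; rewrite /xr zv -aE -bE inj_tperm //; apply: rshift_inj.
apply: (kill _ (Delta t xl * G) _ _ aE bE); first by rewrite /DeltaDelta GE mulrCA.
rewrite /zswap msymM -!/(zswap _ _) sG Delta_fixed // => i.
by rewrite /xl zv -aE -bE tpermD // eq_rlshift.
Qed.

(** * Quantum integers and fillings *)

Definition qratio (C : fieldType) (t : C) (u : nat) : C := qnum t u.+1%:Z / qnum t u%:Z.

Section QuantumIntegers.
Variables (C : fieldType) (t : C).
Hypothesis t_neq0 : t != 0.
Hypothesis t_not_root : forall m : nat, (0 < m)%N -> t ^+ m != 1.

Lemma sqr_expr_neq1 u : (0 < u)%N -> t ^+ u * t ^+ u - 1 != 0.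
Proof. by move=> u0; rewrite subr_eq0 -exprD t_not_root // addn_gt0 u0. Qed.

Lemma qnumE u : qnum t u%:Z = (t ^+ u - (t ^+ u)^-1) / (t - t^-1).
Proof. by rewrite /qnum -exprnN. Qed.

Lemma qnum2 : qnum t 2 = t + t^-1.
Proof.
have h1 := sqr_expr_neq1 (ltn0Sn 0); rewrite expr1 in h1.
by rewrite -[2]/(2%:Z) qnumE expr2; field; rewrite t_neq0 h1.
Qed.

Lemma tau_neq0 : - (t + t^-1) != 0.
Proof.
have h2 : t ^+ 2 * t ^+ 2 - 1 != 0 by apply: sqr_expr_neq1.
apply: contraNneq h2 => h; have {h}: t * (t + t^-1) = 0.
  by rewrite -[t + _]opprK h oppr0 mulr0.
rewrite mulrDr mulfV // => h.
have -> : t ^+ 2 * t ^+ 2 - 1 = (t * t + 1) * (t * t - 1) by rewrite expr2; ring.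
by rewrite h mul0r.
Qed.

Lemma baxter_qratio : baxter_weight (- (t + t^-1)) (qratio t).
Proof.
have h1 := sqr_expr_neq1 (ltn0Sn 0); rewrite expr1 in h1.
split=> [|u u0]; rewrite /qratio !qnumE.
  by rewrite expr1 exprS expr1; field; rewrite t_neq0 h1 oner_neq0.
have hu := sqr_expr_neq1 u0; have hu1 := sqr_expr_neq1 (ltn0Sn u).
have x0 : t ^+ u != 0 by rewrite expf_neq0.
rewrite !exprS in hu1 *; move: (t ^+ u) x0 hu hu1 => x x0 hu hu1.
field.
by rewrite t_neq0 h1 x0 hu /= hu1.
Qed.

Lemma Top_poly_gen (N k u : nat) (f : {mpoly C[N]}) : (0 < k < N)%N -> (0 < u)%N ->
  Top t k u%:Z f = box_op (qratio t) (@poly_gen C t N) k u f.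
Proof.
move=> kN u0; have hu := sqr_expr_neq1 u0.
have h1 := sqr_expr_neq1 (ltn0Sn 0); rewrite expr1 in h1.
have x0 : t ^+ u != 0 by rewrite expf_neq0.
rewrite /Top /box_op poly_genE // -!addrA; congr (_ + _).
rewrite -!scaleNr -!scalerDl /qratio !qnumE -exprnN exprS; congr (_ *: _).
move: (t ^+ u) x0 hu => x x0 hu.
by field; rewrite t_neq0 h1 x0 hu.
Qed.

End QuantumIntegers.

(** The length of row i is given by a function l, and the numbering starts after s, in
    order that the induction on the rows applies to the tail. *)
Lemma foldl_boxes (C : fieldType) (V : lmodType C) (g : nat -> C) (E : nat -> V -> V)
    (op : nat * nat -> V -> V) (l : nat -> nat) n u :
  forall (la : seq nat) (s : nat) (x : V),
  (forall i, (i < size la)%N -> l (s + i).+1 = nth 0%N la i) ->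
  (forall i j y, (j < nth 0 la i)%N ->
     op ((s + i).+1, j.+1) y = box_op g E (n - s - i + j) (u (s + i)%N j) y) ->
  foldl (fun y b => op b y) x
    [seq (i, j) | i <- iota s.+1 (size la), j <- iota 1 (l i)] =
  diag_op g E (n - s) la (fun i => u (s + i)%N) x.
Proof.
elim=> [|m la IH] s x //= Hl Hop.
have row_fold m' : (m' <= m)%N ->
    foldl (fun y b => op b y) x [seq (s.+1, j) | j <- iota 1 m'] =
    row_op g E (n - s) (u (s + 0)%N) m' x.
  elim: m' => [//|m' IHm] hm.
  have -> : iota 1 m'.+1 = iota 1 m' ++ [:: m'.+1].
    by have := iotaD 1 m' 1; rewrite addn1 add1n.
  rewrite map_cat foldl_cat IHm /=; last by lia.
  by have := Hop 0%N m' (row_op g E (n - s) (u (s + 0)%N) m' x) hm; rewrite addn0 subn0.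
rewrite foldl_cat; have := Hl 0%N (ltn0Sn _); rewrite addn0 /= => ->.
rewrite row_fold // IH.
- rewrite (_ : (n - s).-1 = n - s.+1)%N; last by rewrite subnS.
  by rewrite addn0; apply: eq_diag_op => i j _; rewrite addSnnS.
- by move=> i hi; rewrite addSnnS Hl.
- move=> i j y hj; rewrite addSnnS (Hop i.+1) //; congr (box_op _ _ _ _ _).
  by lia.
Qed.

Lemma klrow_decr la j : (0 < klrow la j.+1)%N -> (klrow la j.+1 < klrow la j)%N.
Proof.
elim: la => //= m la IH; rewrite /klrow_step; case: ifP => // jm _.
rewrite (ltnW jm); case: (posnP (klrow la j.+1)) => [->|/IH]; lia.
Qed.

Lemma klrow_rule la j : klrow la j =
  if (j < head 0 la)%N then (maxn (klrow (behead la) j) (klrow la j.+1)).+1 else 0%N.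
Proof.
case: la => //= m la; rewrite /klrow_step; case: ifP => // jm.
case: ifP => jm1; last by lia.
by case: (posnP (klrow la j.+1)) => [->|/klrow_decr]; lia.
Qed.

Lemma KL_filling_klfill la i j : KL_filling la i.+1 j.+1 = klfill la i j.
Proof.
have [d] := ubnP (size la + sumn la - (i + j))%N.
elim: d => // d IH in i j *; rewrite ltnS => hd.
rewrite KL_fillingE /klfill klrow_rule -nth0 nth_drop addn0.
have boxE : ((i.+1, j.+1) \in boxes la) = (j < nth 0 la i)%N by rewrite mem_boxes.
rewrite boxE; case: ifP => // hj; rewrite -boxE in hj.
have := mem_boxes_bound hj => hb.
rewrite (IH i.+1 j) ?(IH i j.+1); try lia.
by rewrite /klfill -drop1 drop_drop add1n.
Qed.

Lemma klrow_rcons0 la j : klrow (rcons la 0%N) j = klrow la j.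
Proof. by elim: la j => //= m la IH j; rewrite /klrow_step IH. Qed.

Lemma nth_staircase n i : nth 0%N (staircase n) i = (n - i.+1)%N.
Proof.
case: (ltnP i n.-1) => h; first by rewrite (nth_map 0%N) ?size_iota // nth_iota // add1n.
by rewrite nth_default ?size_map ?size_iota //; lia.
Qed.

Lemma alternating_tail L a :
  \sum_(j < L) (if (a <= j)%N then (-1) ^+ (L - j.+1) else 0) = (odd (L - a))%:Z :> int.
Proof.
elim: L => [|L IH]; first by rewrite big_ord0.
rewrite big_ord_recr /= subnn expr0.
rewrite (eq_bigr (fun j : 'I_L => - (if (a <= j)%N then (-1) ^+ (L - j.+1) else 0))).
  rewrite sumrN IH; case: leqP => h; first by rewrite subSn //=; case: (odd _).
  have -> : (L - a = 0)%N by lia.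
  by have -> : (L.+1 - a = 0)%N by lia.
move=> j _; case: ifP => _; last by rewrite oppr0.
by rewrite subSn // exprS mulN1r.
Qed.

Lemma big_iota1 n (F : nat -> int) : \sum_(i <- iota 1 n) F i = \sum_(i < n) F i.+1.
Proof. by rewrite -[1%N]addn0 iotaDl big_map -{1}[n]subn0 big_mkord. Qed.

(** Row i of the staircase has n - i.+1 - la_i boxes outside la, with signs
    alternating from + at the outermost box. *)
Lemma nsigned_odd_rows n la :
  nsigned n la = (\sum_(i < n.-1) odd (n - i.+1 - nth 0 la i))%N%:Z.
Proof.
rewrite /nsigned big_mkcond big_allpairs_dep /= size_map size_iota.
rewrite big_iota1 (big_morph Posz PoszD (erefl 0)); apply: eq_bigr => i _.
rewrite /= nth_staircase big_iota1.
rewrite -alternating_tail; apply: eq_bigr => j _.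
by rewrite mem_boxes /= -leqNgt -subnDA subnDA.
Qed.

Lemma link_weight_exp (C : fieldType) (t : C) mu :
  link_weight t mu =
  (- (t + t^-1))^-1 ^+ (\sum_(i < size mu) ~~ odd (size mu - i + nth 0 mu i))%N.
Proof.
elim: mu => [|m mu IH]; first by rewrite big_ord0.
rewrite big_ord_recl exprD -IH /= /arc_weight addSn /=.
by congr (_ * _); case: (odd _).
Qed.

(** * The expansion *)

Section Pairs.
Variables (C : fieldType) (V W : lmodType C) (tau : C) (N : nat).
Variables (E : nat -> V -> V) (E' : nat -> W -> W).

Definition pair_gen k (x : V * W) : V * W := (E k x.1, E' k x.2).

Lemma pair_hecke : hecke_module tau N E -> hecke_module tau N E' ->
  hecke_module tau N pair_gen.
Proof.
move=> [l1 q1 c1 b1] [l2 q2 c2 b2]; split.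
- by move=> k a x y; rewrite /pair_gen /= l1 l2.
- by move=> k x kN; rewrite /pair_gen /= q1 // q2.
- by move=> k l x *; rewrite /pair_gen /= c1 // c2.
- by move=> k x *; congr pair; [apply: b1|apply: b2].
Qed.

End Pairs.

Definition admissible (n : nat) (la : n.-1.-tuple 'I_n) : bool :=
  is_partition (parts la) && subdiagram (parts la) (staircase n).

Lemma admissibleP n (la : n.-1.-tuple 'I_n) : reflect
  (pairwise geq (parts la) /\ forall i, (nth 0 (parts la) i <= n - i.+1)%N)
  (admissible la).
Proof.
have pE : is_partition (parts la) = pairwise geq (parts la).
  by rewrite /is_partition sorted_pairwise // => a b c /= h1 h2; apply: leq_trans h2 h1.
rewrite /admissible pE; apply: (iffP andP) => -[pla H]; split=> //.
  move=> i; case: (posnP (nth 0%N (parts la) i)) => [->//|h].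
  have : (i.+1, nth 0%N (parts la) i) \in boxes (parts la).
    by rewrite mem_boxes /= h leqnn.
  by move=> /(allP H); rewrite /= mem_boxes /= nth_staircase h.
apply/allP => -[i j] /=; rewrite !mem_boxes nth_staircase => /andP[i0 /andP[j0 hj]].
by rewrite i0 j0 /=; apply: leq_trans hj _; apply: leq_trans (H _) _; lia.
Qed.

Lemma size_parts n (la : n.-1.-tuple 'I_n) : size (parts la) = n.-1.
Proof. by rewrite size_map size_tuple. Qed.

Lemma kl_op_rcons0 (C : fieldType) (g : nat -> C) (V : lmodType C) n
    (F : nat -> V -> V) la x :
  kl_op F g n (rcons la 0%N) x = kl_op F g n la x.
Proof.
rewrite /kl_op diag_op_rcons /=; apply: eq_diag_op => i j.
case: (ltnP i (size la)) => [il _|il]; last by rewrite nth_default.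
by rewrite /klfill -cats1 drop_cat il cats1 klrow_rcons0.
Qed.

Section Main.
Variables (C : fieldType) (t : C) (n : nat).
Hypothesis t_neq0 : t != 0.
Hypothesis t_not_root : forall m : nat, (0 < m)%N -> t ^+ m != 1.
Hypothesis n_ge2 : (2 <= n)%N.

Local Notation tau' := (- (t + t^-1)).
Local Notation functional := ((nat -> bool) -> C^o).
Local Notation g := (qratio t).
Local Notation Ep := (@poly_gen C t (n + n)).
Local Notation Es := (tlgen t).
Let E := pair_gen Ep Es.
Let v : {mpoly C[n + n]} * functional := (DeltaDelta t n, step_word C n).

Lemma diagram_polyE la (w : nat -> nat -> int) u :
  (size la < n)%N -> (forall i, nth 0 la i <= n)%N ->
  (forall i j, (j < nth 0 la i)%N -> (0 < u i j)%N /\ w i.+1 j.+1 = (u i j)%:Z) ->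
  diagram_poly t n la w = diag_op g Ep n la u (DeltaDelta t n).
Proof.
move=> szn lan wu.
have := @foldl_boxes C _ g Ep (fun b f => Top t (n + b.2 - b.1) (w b.1 b.2) f)
  (fun i => nth 0%N la i.-1) n u la 0 (DeltaDelta t n).
rewrite subn0; apply=> //= i j y ij.
have il : (i < size la)%N by case: (ltnP i (size la)) ij => // /(nth_default 0%N)->.
have [u0 ->] := wu i j ij; have := lan i.
rewrite ?add0n ?subn0 (_ : n + j.+1 - i.+1 = n - i + j)%N; last by lia.
by move=> ?; apply: Top_poly_gen => //; lia.
Qed.

Lemma KL_kl_op (la : n.-1.-tuple 'I_n) : admissible la ->
  KL t n (parts la) = kl_op Ep g n (parts la) (DeltaDelta t n).
Proof.
move=> /admissibleP[pla hla]; apply: diagram_polyE.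
- by rewrite size_parts; lia.
- by move=> i; have := hla i; lia.
move=> i j ij; split; last by rewrite KL_filling_klfill.
by rewrite /klfill klrow_gt0 -nth0 nth_drop addn0.
Qed.

Lemma Mrho_diag_op : Mrho t n =
  diag_op g Ep n (staircase n) (fun i j => n - i - j)%N (DeltaDelta t n).
Proof.
apply: diagram_polyE.
- by rewrite size_map size_iota; lia.
- by move=> i; rewrite nth_staircase; lia.
move=> i j; rewrite nth_staircase => ij; split; first by lia.
by lia.
Qed.

(** In the direct sum, so that the coefficients a are the same for the polynomials and for
    the spin chain. *)
Lemma kl_expansion : exists a : n.-1.-tuple 'I_n -> C,
  diag_op g E n (staircase n) (fun i j => n - i - j)%N v =
  \sum_(la | admissible la) a la *: kl_op E g n (parts la) v.
Proof.
pose P (x : {mpoly C[n + n]} * functional) := exists a : n.-1.-tuple 'I_n -> C,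
  x = \sum_(la | admissible la) a la *: kl_op E g n (parts la) v.
have P0 : P 0 by exists (fun=> 0); rewrite big1 // => la _; rewrite scale0r.
have PL c x y : P x -> P y -> P (c *: x + y).
  move=> [a ->] [b ->]; exists (fun la => c * a la + b la).
  rewrite scaler_sumr -big_split; apply: eq_bigr => la _ /=.
  by rewrite scalerDl scalerA.
have pst : pairwise geq (staircase n).
  by apply/pairwise_geqP => i j ij; rewrite !nth_staircase; lia.
have szst : size (staircase n) = n.-1 by rewrite size_map size_iota.
have PK mu : pairwise geq mu -> size mu = n.-1 ->
    (forall i, (nth 0 mu i <= nth 0 (staircase n) i)%N) -> P (kl_op E g n mu v).
  move=> pmu szmu lemu; have [n' nE] : exists n', n = n'.+1 by exists n.-1; lia.
  have ltn_mu x : x \in mu -> (x < n)%N.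
    move=> /(nthP 0%N)[i _ <-]; have := lemu i; rewrite nth_staircase => h.
    by apply: leq_ltn_trans h _; lia.
  pose ord x : 'I_n := insubd (Ordinal (ltnW n_ge2 : (0 < n)%N)) x.
  have szo : size (map ord mu) == n.-1 by rewrite size_map szmu.
  pose la : n.-1.-tuple 'I_n := Tuple szo.
  have laE : parts la = mu.
    rewrite /parts /= -map_comp map_id_in // => x /ltn_mu xn.
    by rewrite /= val_insubd xn.
  have adm : admissible la.
    by apply/admissibleP; rewrite laE; split=> // i; have := lemu i; rewrite nth_staircase.
  exists (fun la' => (la' == la)%:R); rewrite (bigD1 la) //= eqxx scale1r laE.
  by rewrite big1 ?addr0 // => la' /andP[_ /negbTE->]; rewrite scale0r.
have heckeE : hecke_module tau' (n + n) E.
  by apply: pair_hecke; [apply: poly_gen_hecke|apply: tlgen_hecke].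
have tri := kl_triangular heckeE (baxter_qratio t_neq0 t_not_root) (n := n) (v := v).
have Pd : P (diag_op g E n (staircase n) (fun i j => n - i - j)%N v
             - kl_op E g n (staircase n) v).
  apply: tri => //.
  - move=> k kN kn; rewrite /E /pair_gen /v /=.
    by rewrite DeltaDelta_kill // tlgen_step.
  - by split=> //; rewrite ?szst -?nth0 ?nth_staircase; lia.
  - by move=> mu pmu szmu lemu _; apply: PK => //; rewrite szmu.
have := PL 1 _ _ Pd (PK _ pst szst (fun i => leqnn _)).
by rewrite scale1r subrK.
Qed.

Lemma diag_op_fst la u x : (diag_op g E n la u x).1 = diag_op g Ep n la u x.1.
Proof. exact: (diag_op_morph (F := fst)). Qed.

Lemma diag_op_snd la u x : (diag_op g E n la u x).2 = diag_op g Es n la u x.2.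
Proof. exact: (diag_op_morph (F := snd)). Qed.

(** The partitions have n - 1 rows and the link patterns n arcs; the missing row is empty. *)
Lemma size_pad (la : n.-1.-tuple 'I_n) : size (rcons (parts la) 0%N) = n.
Proof. by rewrite size_rcons size_parts; lia. Qed.

Lemma pairwise_pad (la : n.-1.-tuple 'I_n) : admissible la ->
  pairwise geq (rcons (parts la) 0%N).
Proof. by move=> /admissibleP[pla _]; rewrite pairwise_rcons pla andbT; apply/allP => x. Qed.

Lemma stair_staircase : stair n = rcons (staircase n) 0%N.
Proof.
apply: (@eq_from_nth _ 0%N).
  by rewrite size_stair size_rcons size_map size_iota; lia.
move=> i; rewrite size_stair => hi; rewrite nth_stair nth_rcons size_map size_iota nth_staircase.
by case: ltngtP => //; lia.
Qed.

Lemma link_eval_kl_parts (la mu : n.-1.-tuple 'I_n) : admissible la -> admissible mu ->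
  link_eval t (rcons (parts mu) 0%N) (kl_op Es g n (parts la) (step_word C n)) =
  (la == mu)%:R.
Proof.
move=> hla hmu; have t0 := tau_neq0 t_neq0 t_not_root.
have szE : size (rcons (parts la) 0%N) = size (rcons (parts mu) 0%N) by rewrite !size_pad.
have := link_eval_kl t_neq0 t0 (baxter_qratio t_neq0 t_not_root)
          (pairwise_pad hla) (pairwise_pad hmu) szE.
rewrite size_pad kl_op_rcons0 => ->.
by rewrite eqseq_rcons eqxx andbT (inj_eq (inj_map val_inj)) (inj_eq val_inj).
Qed.

Lemma link_weight_pad (mu : n.-1.-tuple 'I_n) : admissible mu ->
  link_weight t (rcons (parts mu) 0%N) = Defs.tau t ^ (- nsigned n (parts mu)).
Proof.
move=> hmu; rewrite /Defs.tau qnum2 // link_weight_exp size_pad nsigned_odd_rows.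
rewrite -exprnN -exprVn; congr (_ ^+ _).
have [n' nE] : exists n', n = n'.+1 by exists n.-1; lia.
have [_ le] := admissibleP _ hmu; have szmu := size_parts mu.
move: (parts mu) szmu le => s szs le.
rewrite (_ : n = n'.+1) // big_ord_recr /= nth_rcons szs nE ltnn eqxx subSnn /= addn0.
apply: eq_bigr => i _; have := le i.
have is_ : (i < size s)%N by rewrite szs nE.
rewrite nE nth_rcons is_ => h; lia.
Qed.

(** The spin chain component of the expansion, evaluated at the link pattern of mu. *)
Lemma kl_coefficient a (mu : n.-1.-tuple 'I_n) : admissible mu ->
  diag_op g E n (staircase n) (fun i j => n - i - j)%N v =
    \sum_(la | admissible la) a la *: kl_op E g n (parts la) v ->
  a mu = Defs.tau t ^ (- nsigned n (parts mu)).
Proof.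
move=> hmu /(congr1 snd); rewrite diag_op_snd (big_morph snd (id1 := 0) (op1 := +%R)) //.
have -> : diag_op g Es n (staircase n) (fun i j => n - i - j)%N v.2 =
          macdonald t g n (step_word C n).
  by rewrite /macdonald stair_staircase diag_op_rcons.
have t0 := tau_neq0 t_neq0 t_not_root.
have baxter := baxter_qratio t_neq0 t_not_root.
have [_ le] := admissibleP _ hmu.
pose ev := link_eval t (rcons (parts mu) 0%N).
move=> /(congr1 ev).
have ev_lin c x y : ev (c *: x + y) = c * ev x + ev y by apply: link_eval_linear.
have evD : {morph ev : x y / x + y}.
  by move=> x y; rewrite -[x]scale1r ev_lin mul1r scale1r.
have ev0 : ev 0 = 0 by apply: link_eval0.
have := link_eval_macdonald t_neq0 t0 baxter (mu := rcons (parts mu) 0%N).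
rewrite size_pad -/ev => -> => [|i i_n]; last first.
  rewrite nth_rcons size_parts; case: (ltngtP i n.-1) => hi; try lia.
  by apply: leq_ltn_trans (le i) _; lia.
rewrite link_weight_pad // => ->; rewrite (big_morph ev evD ev0) (bigD1 mu) //=.
have snd_ev (la : n.-1.-tuple 'I_n) : admissible la ->
    ev (a la *: kl_op E g n (parts la) v).2 = a la * (la == mu)%:R.
  move=> hla; rewrite -[(_ *: _).2]/(a la *: (kl_op E g n (parts la) v).2).
  rewrite /kl_op diag_op_snd -[diag_op _ _ _ _ _ _]/(kl_op Es g n (parts la) _).
  by rewrite -[_ *: _]addr0 ev_lin ev0 addr0 /ev link_eval_kl_parts.
rewrite snd_ev // eqxx mulr1 big1 ?addr0 // => la /andP[hla ne].
by rewrite snd_ev // (negbTE ne) mulr0.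
Qed.

End Main.

Theorem corollary1 (R : realType) (t : R[i]) (n : nat)
    (t_neq0 : t != 0)
    (t_not_root_of_unity : forall m : nat, (0 < m)%N -> t ^+ m != 1)
    (n_ge2 : (2 <= n)%N) :
  Mrho t n =
  \sum_(la : n.-1.-tuple 'I_n |
          is_partition (parts la) && subdiagram (parts la) (staircase n))
     tau t ^ (- nsigned n (parts la)) *: KL t n (parts la).
Proof.
have [a aE] := kl_expansion t_neq0 t_not_root_of_unity n_ge2.
rewrite Mrho_diag_op //; have := congr1 fst aE.
rewrite diag_op_fst (big_morph fst (id1 := 0) (op1 := +%R)) //= => ->.
apply: eq_bigr => la hla.
rewrite -(kl_coefficient t_neq0 t_not_root_of_unity n_ge2 hla aE) KL_kl_op //.
rewrite -[LHS]/(a la *: (kl_op _ _ _ _ _).1); congr (_ *: _).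
by rewrite /kl_op diag_op_fst.
Qed.
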